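(* Let $N\geq 3$, $p>1$ and $m\in\mathbb N$ be fixed, and set $\alpha_p:=\max\left\{0,\frac{p(N-2)-(N+2)}{2}\right\}$. For $\alpha>\alpha_p$ let $u_\alpha$ be the unique radial $C^2(\overline{B^N})$ solution of $$-\Delta u=|x|^\alpha|u|^{p-1}u \text{ in } B^N,\qquad u=0 \text{ on }\partial B^N,$$ with exactly $m$ nodal sets and $u_\alpha(0)>0$, and let $w$ be the unique radial solution of $$-\Delta w=|w|^{p-1}w \text{ in } B^2,\qquad w=0 \text{ on }\partial B^2,$$ with exactly $m$ nodal sets and $w(0)>0$. Then the functions $$v_\alpha(t):=\left(\frac{2}{\alpha+2}\right)^{\frac{2}{p-1}}u_\alpha\left(t^{\frac{2}{\alpha+2}}\right),\quad t\in[0,1],$$ converge to $w$ in $C^1([0,1])\cap C^2([\varepsilon,1])$ as $\alpha\to\infty$, for every $\varepsilon\in(0,1)$.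
   Context: $B^N\subset\mathbb R^N$ and $B^2\subset\mathbb R^2$ denote the open unit balls centered at the origin. Radial functions on $\overline{B^N}$ (resp. $\overline{B^2}$) are identified with functions of the radius on $[0,1]$. A ''nodal set'' of a function means a connected component of the set where it does not vanish. *)

(* Defs.v *)
From HB Require Import structures.
From mathcomp Require Import all_boot all_order all_algebra.
From mathcomp Require Import all_classical all_reals all_analysis.
Set Implicit Arguments. Unset Strict Implicit. Unset Printing Implicit Defensive.
Import Order.TTheory GRing.Theory Num.Theory.
Import numFieldNormedType.Exports.
Local Open Scope classical_set_scope.
Local Open Scope ring_scope.

Definition I01 {R : realType} : set R := [set x | 0 <= x <= 1].

Definition has_deriv_on {R : realType} (A : set R) (f f' : R -> R) : Prop :=
  forall x, A x ->
    (fun y => (f y - f x) / (y - x)) @ within A (nbhs x^') --> f' x.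

(* Number of nodal sets of a radial function f on the unit ball, read on the
   radial variable: the connected components of {r in [0,1) | f r <> 0}
   (these are in bijection with the connected components of
   {x in B | f(|x|) <> 0} when the dimension is >= 2). *)
Definition nodal_radii {R : realType} (f : R -> R) : set R :=
  [set r | 0 <= r < 1 /\ f r != 0].

Definition has_n_nodal_sets {R : realType} (f : R -> R) (m : nat) : Prop :=
  ((connected_component (nodal_radii f)) @` (nodal_radii f) #= `I_m)%card.

(* f (as a function of the radius r = |x|) is a radial C^2(closed ball)
   solution of  -Δu = |x|^a |u|^(p-1) u  in B^N, u = 0 on ∂B^N.
   f1, f2 are the first and second derivatives of f on [0,1] (one-sided at
   the endpoints), f2 continuous on [0,1]; f1 0 = 0 (radial C^1 at the
   origin); the radial form of the Laplacian  Δu = u'' + (N-1)/r u'  is used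
   for 0 < r < 1 (at r = 0 the equation follows by continuity). *)
Definition radial_sol {R : realType} (N a p : R) (f : R -> R) : Prop :=
  exists f1 f2 : R -> R,
    [/\ has_deriv_on I01 f f1, has_deriv_on I01 f1 f2,
        {within I01, continuous f2},
        f1 0 = 0 /\ f 1 = 0 &
        forall r, 0 < r < 1 ->
          - (f2 r + (N - 1) / r * f1 r) = r `^ a * (`|f r| `^ (p - 1) * f r)].

Definition alpha_p {R : realType} (N p : R) : R :=
  Num.max 0 ((p * (N - 2) - (N + 2)) / 2).

(* Main.v *)
(** With k = 2/(a+2), the change of variable r = t^k turns the equation in
    dimension N with weight |x|^a into the autonomous equation
    v'' + (M-1)/t v' + |v|^(p-1) v = 0 in the real "dimension" M = 2 + k(N-2),
    which tends to 2; the planar profile w is the case M = 2.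
    By scaling, every such v is d y(L t) with y(0) = 1, L^2 = d^(p-1), where L
    is the m-th zero of y.  For 2 <= M <= 3 the energy y'^2/2 + |y|^(p+1)/(p+1)
    is nonincreasing while t^4 times it is nondecreasing, so |y|, |y'|, |y''|
    are bounded and the zeros of y are simple, uniformly in M on bounded
    intervals.  A Gronwall estimate shows that the normalised profiles for M
    and 2 are C^1-close on their common interval.  If one of the two lengths L
    exceeded the other by delta, each of the m zeros of the shorter profile
    would give a distinct zero of the longer one strictly before its last zero,
    contradicting equality of the numbers of zeros.  Hence the lengths, and
    then v and v', converge; v'' follows from the equation. *)
Require Import Defs.
From HB Require Import structures.
From mathcomp Require Import all_boot all_order all_algebra.
From mathcomp Require Import all_classical all_reals all_analysis.
From mathcomp Require Import ring lra.
Set Implicit Arguments. Unset Strict Implicit. Unset Printing Implicit Defensive.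
Import Order.TTheory GRing.Theory Num.Theory.
Import numFieldNormedType.Exports.
Local Open Scope classical_set_scope.
Local Open Scope ring_scope.

(** * Calculus on subsets of the line *)

Definition seg {R : realType} (a b : R) : set R := [set t | a <= t <= b].

(** Relative continuity stated pointwise with a filter, so that limits combine by the [cvg] lemmas;
    [cont_onP] identifies it with the subspace continuity that [MVT], [IVT] and [EVT_max] take as
    input. *)
Definition cont_on {R : realType} (A : set R) (f : R -> R) : Prop :=
  forall x, A x -> f @ within A (nbhs x) --> f x.

Section RealCalculus.
Context {R : realType}.
Implicit Types (f g F : R -> R) (A B : set R).

Lemma segE (a b : R) : seg a b = [set` `[a, b]].
Proof. by apply/seteqP; split=> t /=; rewrite in_itv. Qed.

Lemma cont_onP A f : cont_on A f <-> {within A, continuous f}.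
Proof. by symmetry; apply: subspace_continuousP. Qed.

Lemma cont_on_sub A B f : A `<=` B -> cont_on B f -> cont_on A f.
Proof.
move=> AB cf x Ax; have h := cf x (AB x Ax); apply: cvg_trans h; apply: cvg_app => P.
by apply: (@filterS _ (nbhs x)) => y h /AB.
Qed.

Lemma cont_onT A f : continuous f -> cont_on A f.
Proof. by move=> cf x Ax; have h := cf x; apply: cvg_trans h; apply: cvg_app; exact: cvg_within. Qed.

Lemma cont_onD A f g :
  cont_on A f -> cont_on A g -> cont_on A (fun t => f t + g t).
Proof. by move=> cf cg x Ax; apply: cvgD; [apply: cf|apply: cg]. Qed.

Lemma cont_onB A f g :
  cont_on A f -> cont_on A g -> cont_on A (fun t => f t - g t).
Proof. by move=> cf cg x Ax; apply: cvgB; [apply: cf|apply: cg]. Qed.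

Lemma cont_onM A f g :
  cont_on A f -> cont_on A g -> cont_on A (fun t => f t * g t).
Proof. by move=> cf cg x Ax; apply: cvgM; [apply: cf|apply: cg]. Qed.

Lemma cont_on_cst A (c : R) : cont_on A (fun=> c).
Proof. by apply: cont_onT => x; apply: cvg_cst. Qed.

Lemma cont_on_id A : cont_on A (fun t : R => t).
Proof. by apply: cont_onT => x. Qed.

Lemma cont_onX A f n : cont_on A f -> cont_on A (fun t => f t ^+ n).
Proof.
move=> cf; elim: n => [|n IH]; first exact: cont_on_cst.
have -> : (fun t => f t ^+ n.+1) = (fun t => f t * f t ^+ n).
  by apply/funext => t; rewrite exprS.
exact: cont_onM.
Qed.

Lemma cont_on_eq A f g : (forall x, A x -> f x = g x) -> cont_on A f -> cont_on A g.
Proof.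
move=> fg cf x Ax; rewrite -(fg x Ax); have h := cf x Ax; apply: cvg_trans h.
by apply: fmap_within_eq => y yA; rewrite fg//; exact: set_mem.
Qed.

Lemma cont_on_comp A B f g : (forall x, A x -> B (f x)) ->
  cont_on A f -> cont_on B g -> cont_on A (g \o f).
Proof.
move=> AB cf cg x Ax; have h := cg _ (AB x Ax); apply: cvg_comp h => P.
move=> /(cf x Ax).
by apply: (@filterS _ (nbhs x)) => y h Ay; apply: h => //; apply: AB.
Qed.

(** Allows a derivative to be assembled by the rules first and its value to be matched by [ring] or
    [field] afterwards. *)
Lemma derE f (x d d' : R) : is_derive x 1 f d -> d = d' -> is_derive x 1 f d'.
Proof. by move=> h <-. Qed.

Lemma derD f g (x a b : R) : is_derive x 1 f a -> is_derive x 1 g b ->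
  is_derive x 1 (fun t => f t + g t) (a + b).
Proof. exact: is_deriveD. Qed.

Lemma derB f g (x a b : R) : is_derive x 1 f a -> is_derive x 1 g b ->
  is_derive x 1 (fun t => f t - g t) (a - b).
Proof. exact: is_deriveB. Qed.

Lemma derM f g (x a b : R) : is_derive x 1 f a -> is_derive x 1 g b ->
  is_derive x 1 (fun t => f t * g t) (f x * b + g x * a).
Proof. exact: is_deriveM. Qed.

Lemma der_cst (c x : R) : is_derive x 1 (fun=> c) 0.
Proof. exact: is_derive_cst. Qed.

Lemma der_id (x : R) : is_derive x 1 (fun t => t) 1.
Proof. exact: is_derive_id. Qed.

Lemma der_scale f (x a c : R) : is_derive x 1 f a ->
  is_derive x 1 (fun t => c * f t) (c * a).
Proof.
by move=> h; have := derM (der_cst c x) h; rewrite mulr0 addr0.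
Qed.

Lemma der_sqr f (x a : R) : is_derive x 1 f a ->
  is_derive x 1 (fun t => f t ^+ 2) (2 * f x * a).
Proof.
move=> h; apply: (derE (derM h h)); ring.
Qed.

Lemma der_comp f g (x a b : R) : is_derive (g x) 1 f a -> is_derive x 1 g b ->
  is_derive x 1 (fun t => f (g t)) (a * b).
Proof. exact: is_derive1_comp. Qed.

Lemma der_cont f (x d : R) : is_derive x 1 f d -> {for x, continuous f}.
Proof. by move=> [h _]; apply: differentiable_continuous; apply/derivable1_diffP. Qed.

Lemma mean_value (F F' : R -> R) (a b : R) : a < b -> cont_on (seg a b) F ->
  (forall x, a < x < b -> is_derive x 1 F (F' x)) ->
  exists2 c, a < c < b & F b - F a = F' c * (b - a).
Proof.
move=> ab /cont_onP cF dF.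
have dF' x : x \in `]a, b[%R -> is_derive x 1 F (F' x).
  by rewrite in_itv; apply: dF.
rewrite segE in cF; have [c] := MVT ab dF' cF.
by rewrite in_itv => h1 h2; exists c.
Qed.

Lemma deriv_ge0_le (F F' : R -> R) (a b : R) : a <= b -> cont_on (seg a b) F ->
  (forall x, a < x < b -> is_derive x 1 F (F' x)) ->
  (forall x, a < x < b -> 0 <= F' x) -> F a <= F b.
Proof.
rewrite le_eqVlt => /orP[/eqP -> //|ab] cF dF p.
have [c h1 h2] := mean_value ab cF dF.
by rewrite -subr_ge0 h2 mulr_ge0 ?p// subr_ge0 ltW.
Qed.

Lemma deriv_bound (F F' : R -> R) (a b K : R) : a <= b -> cont_on (seg a b) F ->
  (forall x, a < x < b -> is_derive x 1 F (F' x)) ->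
  (forall x, a < x < b -> `|F' x| <= K) -> `|F b - F a| <= K * (b - a).
Proof.
rewrite le_eqVlt => /orP[/eqP ->|ab] cF dF p; first by rewrite !subrr mulr0 normr0.
have [c h1 ->] := mean_value ab cF dF.
by rewrite normrM (@gtr0_norm _ (b - a)) ?subr_gt0// ler_pM2r ?subr_gt0// p.
Qed.

Lemma ivt0 f (a b : R) : a <= b -> cont_on (seg a b) f -> f a <= 0 <= f b ->
  exists2 c, a <= c <= b & f c = 0.
Proof.
move=> ab /cont_onP cf /andP[fa fb].
rewrite segE in cf; have [|c] := @IVT _ f a b 0 ab cf.
  by rewrite ge_min fa le_max fb orbT.
by rewrite in_itv; exists c.
Qed.

Lemma cont_on_bounded f (a b : R) : a <= b -> cont_on (seg a b) f ->
  exists C, forall t, a <= t <= b -> `|f t| <= C.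
Proof.
move=> ab /cont_onP; rewrite segE => cf.
have cn : {within `[a, b], continuous (fun t => `|f t|)}.
  move=> x; apply: (@continuous_comp (subspace _) R R f Num.norm); first exact: cf.
  exact: norm_continuous.
have [c h1 h2] := EVT_max ab cn.
by exists `|f c| => t h; apply: h2; rewrite in_itv.
Qed.

End RealCalculus.

(** * The power nonlinearity *)

(** The odd power; [phi p x * x] is |x|^(p+1), the potential in the energy up to the factor
    1/(p+1). *)
Definition phi {R : realType} (p x : R) : R := `|x| `^ (p - 1) * x.

Section PowerNonlinearity.
Context {R : realType}.
Implicit Types p x y d B : R.

Lemma powR_small (k e t : R) : 0 < k -> 0 < e -> 0 <= t < e `^ k^-1 -> t `^ k < e.
Proof.
move=> k0 e0 /andP[t0 te].
have -> : e = (e `^ k^-1) `^ k by rewrite -powRrM mulVf ?gt_eqF// powRr1// ltW.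
by apply: gt0_ltr_powR => //; rewrite nnegrE// powR_ge0.
Qed.

Lemma phiN p x : phi p (- x) = - phi p x.
Proof. by rewrite /phi normrN mulrN. Qed.

Lemma phi_powR p x : 1 < p -> 0 <= x -> phi p x = x `^ p.
Proof. move=> p1 x0; rewrite /phi ger0_norm// mulrC mulr_powRB1//; lra. Qed.

Lemma phi0 p : phi p 0 = 0.
Proof. by rewrite /phi mulr0. Qed.

Lemma phiM p d x : 0 <= d -> phi p (d * x) = d `^ (p - 1) * d * phi p x.
Proof.
move=> d0; rewrite /phi normrM (ger0_norm d0) powRM//; ring.
Qed.

Lemma norm_phi_le p x B : 1 < p -> `|x| <= B -> `|phi p x| <= B `^ (p - 1) * `|x|.
Proof.
move=> p1 xB; rewrite /phi normrM (ger0_norm (powR_ge0 _ _)).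
apply: ler_wpM2r => //; apply: ge0_ler_powR; rewrite ?nnegrE//; first lra.
exact: le_trans xB.
Qed.

(** Mean value theorem for t^p when x > 0, where the power is differentiable; for x = 0 the growth
    bound [norm_phi_le] suffices. *)
Lemma phi_lip_ge0 p x y B : 1 < p -> 0 <= x <= y -> y <= B ->
  `|phi p y - phi p x| <= p * B `^ (p - 1) * (y - x).
Proof.
move=> p1 /andP[+ xy] yB; rewrite le_eqVlt => /orP[/eqP x0|x0].
  rewrite -x0 in xy *; rewrite phi0 !subr0.
  have yB' : `|y| <= B by rewrite ger0_norm.
  apply: (le_trans (norm_phi_le p1 yB')); rewrite (ger0_norm xy) -mulrA.
  by rewrite ler_peMl ?mulr_ge0 ?powR_ge0// ltW.
have d (t : R) : 0 < t -> is_derive t 1 (fun t : R => t `^ p) (p * t `^ (p - 1)).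
  exact: is_derive1_powR.
have y0 : 0 <= y by lra.
rewrite (phi_powR p1 y0) (phi_powR p1 (ltW x0)).
apply: (@deriv_bound R (fun t => t `^ p) (fun t => p * t `^ (p - 1)) x y (p * B `^ (p - 1))) => //.
- move=> t /andP[xt _]; have t0 : 0 < t by exact: lt_le_trans xt.
  have h := der_cont (d t t0); apply: cvg_trans h; apply: cvg_app; exact: cvg_within.
- by move=> t /andP[xt _]; apply: d; exact: lt_trans xt.
- move=> t /andP[xt ty]; have t0 : 0 < t by exact: lt_trans xt.
  rewrite ger0_norm ?mulr_ge0 ?powR_ge0//; last by lra.
  apply: ler_wpM2l; first by lra.
  apply: ge0_ler_powR; rewrite ?nnegrE; lra.
Qed.

(** Arguments of equal sign reduce to [phi_lip_ge0] by oddness. For opposite signs |y - x| = |x| +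
    |y|, and the growth bounds of the two values add up. *)
Lemma phi_lip p x y B : 1 < p -> `|x| <= B -> `|y| <= B ->
  `|phi p y - phi p x| <= p * B `^ (p - 1) * `|y - x|.
Proof.
move=> p1; wlog xy : x y / x <= y.
  move=> h xB yB; case: (leP x y) => [xy|yx]; first exact: h.
  by rewrite distrC [in leRHS]distrC h// ltW.
move=> xB yB; rewrite (@ger0_norm _ (y - x)) ?subr_ge0//.
have pB : 0 <= B `^ (p - 1) by exact: powR_ge0.
case: (leP 0 x) => x0.
  apply: phi_lip_ge0; rewrite ?x0//.
  by apply: le_trans yB; rewrite ler_norm.
case: (leP y 0) => y0.
  have -> : phi p y - phi p x = phi p (- x) - phi p (- y) by rewrite !phiN; ring.
  have -> : y - x = - x - - y by ring.
  apply: phi_lip_ge0 => //; first by apply/andP; split; lra.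
  by apply: le_trans xB; rewrite -normrN ler_norm.
have hx := norm_phi_le p1 xB; have hy := norm_phi_le p1 yB.
rewrite (ltr0_norm x0) in hx; rewrite (gtr0_norm y0) in hy.
apply: (le_trans (ler_normB _ _)); apply: (le_trans (lerD hy hx)).
rewrite -mulrDr -mulrA ler_peMl//; last exact: ltW.
by rewrite mulr_ge0//; lra.
Qed.

Lemma phi_cont p : 1 < p -> continuous (phi p).
Proof.
move=> p1 x; apply/(@cvgrPdistC_lt _ R) => e e0.
set K := p * (`|x| + 1) `^ (p - 1).
have K0 : 0 < K by rewrite mulr_gt0 ?powR_gt0 ?ltr_wpDl//; lra.
have d0 : 0 < Num.min 1 (e / K) by rewrite lt_min ltr01 divr_gt0.
near=> t.
have : `|t - x| < Num.min 1 (e / K).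
  by rewrite distrC; near: t; apply/nbhs_ballP; exists (Num.min 1 (e / K)).
rewrite lt_min => /andP[h1 h2].
have hx : `|x| <= `|x| + 1 by lra.
have ht : `|t| <= `|x| + 1.
  have -> : t = x + (t - x) by ring.
  by apply: (le_trans (ler_normD _ _)); rewrite lerD2l ltW.
apply: (le_lt_trans (phi_lip p1 hx ht)).
by rewrite -/K mulrC -ltr_pdivlMr.
Unshelve. all: by end_near. Qed.

Lemma phi_mul_ge0 p x : 0 <= phi p x * x.
Proof. by rewrite /phi -mulrA mulr_ge0 ?powR_ge0// -expr2 sqr_ge0. Qed.

Lemma phi_mul_le p x y : 1 < p -> `|x| <= `|y| -> phi p x * x <= phi p y * y.
Proof.
move=> p1 xy; rewrite /phi -!mulrA -!expr2 -(real_normK (num_real x)) -(real_normK (num_real y)).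
apply: ler_pM; rewrite ?powR_ge0 ?sqr_ge0//.
  by apply: ge0_ler_powR; rewrite ?nnegrE//; lra.
by apply: lerXn2r.
Qed.

Lemma phi1 p : phi p 1 = 1.
Proof. by rewrite /phi normr1 powR1 mulr1. Qed.

Lemma norm_le1 p x : 1 < p -> phi p x * x <= 1 -> `|x| <= 1.
Proof.
move=> p1; apply: contraTT; rewrite -!ltNge => x1.
rewrite /phi -mulrA -expr2 -(real_normK (num_real x)).
have h : 1 `^ (p - 1) <= `|x| `^ (p - 1).
  by apply: ge0_ler_powR; rewrite ?nnegrE//; lra.
rewrite powR1 in h.
have h2 : 1 < `|x| ^+ 2 by rewrite expr_gt1// ltW.
apply: (lt_le_trans h2); rewrite ler_peMl//; exact: sqr_ge0.
Qed.

(** For positive x this is the derivative of t^(p+1); negative x follows by evenness. At 0 the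
    Carathéodory slope function is [phi p] itself, continuous with value 0. *)
Lemma der_phi_mul p x : 1 < p ->
  is_derive x 1 (fun t => phi p t * t) ((p + 1) * phi p x).
Proof.
move=> p1; have pos (y : R) : 0 < y -> is_derive y 1 (fun t => phi p t * t) ((p + 1) * phi p y).
  move=> y0; have h : is_derive y 1 (fun t : R => t `^ (p + 1)) ((p + 1) * y `^ (p + 1 - 1)).
    exact: is_derive1_powR.
  rewrite phi_powR ?(ltW y0)//.
  apply: (derE (near_eq_is_derive _ h)); last by rewrite addrK.
  near=> t.
  have t0 : 0 < t by near: t; exact: lt_nbhsr.
  rewrite phi_powR ?(ltW t0)// powRD ?powRr1//; first exact: ltW.
  by rewrite gt_eqF//; lra.
case: (ltgtP x 0) => [x0|/pos//|->]; last first.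
  rewrite phi0 mulr0; apply/is_derive1_caratheodory; exists (phi p); split.
  - by move=> z; rewrite phi0 mulr0 !subr0.
  - exact: phi_cont.
  - exact: phi0.
have nx : 0 < - x by rewrite oppr_gt0.
have dN : is_derive x 1 (fun t : R => - t) (- 1 : R).
  by have := @is_deriveN _ R R id x 1 1 (is_derive_id _ _).
have := der_comp (pos _ nx) dN.
rewrite (_ : (fun t => _) = (fun t => phi p t * t)); last first.
  by apply/funext => t; rewrite phiN mulrNN.
by move=> h; apply: (derE h); rewrite phiN; ring.
Unshelve. all: by end_near. Qed.

End PowerNonlinearity.

(** * The radial equation in real dimension *)

(** The dimension [M] is a real number because the change of variable produces non-integer values.
    Derivatives are required only inside the interval, with continuity up to the ends, so the
    coefficient (M-1)/t is never met at 0. *)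
Definition emden {R : realType} (M p L : R) (f f1 : R -> R) : Prop :=
  [/\ cont_on (seg 0 L) f, cont_on (seg 0 L) f1, f1 0 = 0, f L = 0 &
      forall t, 0 < t < L -> is_derive t 1 f (f1 t) /\
        is_derive t 1 f1 (- ((M - 1) / t * f1 t) - phi p (f t))].

Section Emden.
Context {R : realType}.
Implicit Types (M p L t : R) (f g : R -> R).

Lemma powR_cont_on (k : R) : 0 < k -> cont_on [set t : R | 0 <= t] (fun t => t `^ k).
Proof.
move=> k0 x /=; rewrite le_eqVlt => /orP[/eqP <-|x0]; last first.
  have h := der_cont (is_derive1_powR k x0).
  by apply: cvg_trans h; apply: cvg_app; exact: cvg_within.
apply/(@cvgrPdistC_lt _ R) => e e0.
rewrite powR0 ?gt_eqF//.
have d0 : 0 < e `^ k^-1 by exact: powR_gt0.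
near=> t.
have t0 : 0 <= t by near: t; exact: withinT.
rewrite subr0 ger0_norm ?powR_ge0//; apply: powR_small => //; rewrite t0/=.
have : `|0 - t| < e `^ k^-1.
  near: t; apply: cvg_within; apply/nbhs_ballP; exists (e `^ k^-1) => //.
by rewrite sub0r normrN ger0_norm.
Unshelve. all: by end_near. Qed.

(** With the integrating factor t^(M-1), the derivative of t^(M-1) f1 + C t^M is t^(M-1) (C M - g)
    >= 0, and this function vanishes at 0. Continuity is asked of t^(M-1) f1 and not of f1, since
    [vfun1_bound] applies the estimate before continuity of the derivative at 0 is known. *)
Lemma damped_ge M L C f1 g : 1 <= M -> 0 <= C ->
  (forall t, 0 < t < L -> is_derive t 1 f1 (- ((M - 1) / t * f1 t) - g t)) ->
  (forall t, 0 < t < L -> `|g t| <= C) ->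
  cont_on (seg 0 L) (fun t => t `^ (M - 1) * f1 t) ->
  0 `^ (M - 1) * f1 0 = 0 ->
  forall t, 0 < t <= L -> - (C * t) <= f1 t.
Proof.
move=> M1 C0 df gC cw w0 t /andP[t0 tL].
set F := fun s => s `^ (M - 1) * f1 s + C * s `^ M.
have M0 : 0 < M by lra.
have wM s : 0 <= s -> s `^ M = s `^ (M - 1) * s by move=> s0; rewrite mulrC mulr_powRB1.
suff : F 0 <= F t.
  rewrite /F w0 add0r powR0 ?gt_eqF// mulr0 wM ?(ltW t0)//.
  have -> : t `^ (M - 1) * f1 t + C * (t `^ (M - 1) * t)
      = t `^ (M - 1) * (f1 t + C * t) by ring.
  by rewrite pmulr_rge0 ?powR_gt0//; lra.
apply: (@deriv_ge0_le R F (fun s => s `^ (M - 1) * (C * M - g s)) 0 t).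
- exact: ltW.
- apply: cont_onD.
    apply: cont_on_sub cw => s /andP[s0 st].
    by rewrite /seg /= s0; exact: le_trans tL.
  apply: cont_onM; first exact: cont_on_cst.
  by apply: cont_on_sub (powR_cont_on M0) => s /= /andP[].
- move=> s /andP[s0 st].
  have sL : 0 < s < L by rewrite s0 (lt_le_trans st).
  apply: derE.
    apply: derD; last by apply: der_scale; exact: is_derive1_powR.
    by apply: derM; [exact: is_derive1_powR|exact: df].
  have -> : s `^ (M - 1) = s `^ (M - 1 - 1) * s.
    case: (eqVneq M 1) => [->|M1'].
      by rewrite subrr sub0r powRr0 powRN powRr1 ?(ltW s0)// mulVf// gt_eqF.
    rewrite mulrC mulr_powRB1 ?(ltW s0)//.
    by rewrite subr_gt0 lt_neqAle eq_sym M1'.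
  by field; rewrite gt_eqF.
- move=> s /andP[s0 st].
  have sL : 0 < s < L by rewrite s0 (lt_le_trans st).
  rewrite mulr_ge0 ?powR_ge0// subr_ge0.
  apply: (le_trans (ler_norm _)); apply: (le_trans (gC s sL)).
  by rewrite ler_peMr.
Qed.

Lemma damped_bound M L C f1 g : 1 <= M -> 0 <= C ->
  (forall t, 0 < t < L -> is_derive t 1 f1 (- ((M - 1) / t * f1 t) - g t)) ->
  (forall t, 0 < t < L -> `|g t| <= C) ->
  cont_on (seg 0 L) (fun t => t `^ (M - 1) * f1 t) ->
  0 `^ (M - 1) * f1 0 = 0 ->
  forall t, 0 < t <= L -> `|f1 t| <= C * t.
Proof.
move=> M1 C0 df gC cw w0 t tL; rewrite ler_norml (damped_ge M1 C0 df gC)//= -lerN2.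
apply: (@damped_ge M L C (fun s => - f1 s) (fun s => - g s)) => //.
- move=> s sL; apply: derE; last first.
    by rewrite (_ : _ - _ = -1 * (- ((M - 1) / s * f1 s) - g s)); [|ring].
  rewrite (_ : (fun x => - f1 x) = (fun x => -1 * f1 x)).
    by apply: der_scale; exact: df.
  by apply/funext => x; rewrite mulN1r.
- by move=> s sL; rewrite normrN; exact: gC.
- apply: (@cont_on_eq _ _ (fun s => -1 * (s `^ (M - 1) * f1 s))).
    by move=> s _; ring.
  by apply: cont_onM => //; exact: cont_on_cst.
- by rewrite mulrN w0 oppr0.
Qed.

Definition energy p f f1 (t : R) : R := 2^-1 * f1 t ^+ 2 + (p + 1)^-1 * (phi p (f t) * f t).

(** The potential energy at height 1/2. It bounds the energy at t = 1 from below, since a profile of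
    unit height is still at least 1/2 there. *)
Definition energy_half p : R := (p + 1)^-1 * (phi p 2^-1 * 2^-1).

(** Multiplying the equation by f1 cancels the nonlinear terms and leaves only the damping. *)
Lemma der_energy M p L f f1 t : 1 < p -> 0 < t < L -> emden M p L f f1 ->
  is_derive t 1 (energy p f f1) (- ((M - 1) / t * f1 t ^+ 2)).
Proof.
move=> p1 tL [_ _ _ _ /(_ t tL) [d1 d2]].
have e1 := der_scale 2^-1 (der_sqr d2).
have e2 := der_scale (p + 1)^-1 (der_comp (der_phi_mul _ p1) d1).
apply: (derE (derD e1 e2)).
have t0 : t != 0 by case/andP: tL => h _; rewrite gt_eqF.
have p0 : p + 1 != 0 by rewrite gt_eqF//; lra.
by field; rewrite ?t0 ?p0.
Qed.

Lemma cont_energy M p L f f1 : 1 < p -> emden M p L f f1 -> cont_on (seg 0 L) (energy p f f1).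
Proof.
move=> p1 [cf cf1 _ _ _].
have cp : cont_on (seg 0 L) (phi p \o f).
  by apply: (@cont_on_comp _ _ setT) => //; apply: cont_onT; exact: phi_cont.
apply: cont_onD; apply: cont_onM; try exact: cont_on_cst.
  exact: cont_onX.
exact: cont_onM.
Qed.

End Emden.

(** * A priori bounds for profiles of unit height, uniform in the dimension *)

Definition normalised {R : realType} (M p L : R) (f f1 : R -> R) : Prop :=
  [/\ emden M p L f f1, f 0 = 1, 0 < L, 1 < p & 2 <= M <= 3].

Section Normalised.
Context {R : realType}.
Implicit Types (M p L s t : R) (f g : R -> R).

Lemma normalised_energy_le M p L f f1 t : normalised M p L f f1 -> 0 <= t <= L ->
  energy p f f1 t <= (p + 1)^-1.
Proof.
move=> [em f0 L0 p1 /andP[M2 M3]] /andP[t0 tL].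
have [_ _ f10 _ _] := em.
have -> : (p + 1)^-1 = energy p f f1 0.
  by rewrite /energy f10 f0 phi1 expr0n/= mulr0 add0r !mulr1.
rewrite -lerN2.
apply: (@deriv_ge0_le R (fun s => - energy p f f1 s)
  (fun s => (M - 1) / s * f1 s ^+ 2) 0 t) => //.
- apply: (@cont_on_sub _ _ (seg 0 L)).
    by move=> s /andP[s0 st]; rewrite /seg /= s0 (le_trans st).
  apply: (@cont_on_eq _ _ (fun s => 0 - energy p f f1 s)); first by move=> s _; rewrite sub0r.
  by apply: cont_onB; [exact: cont_on_cst|exact: (cont_energy p1 em)].
- move=> s /andP[s0 st]; have sL : 0 < s < L by rewrite s0 (lt_le_trans st).
  have := der_scale (-1) (der_energy p1 sL em).
  rewrite mulN1r opprK (_ : (fun t => _) = (fun s => - energy p f f1 s))//.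
  by apply/funext => x; rewrite mulN1r.
- move=> s /andP[s0 st]; rewrite mulr_ge0 ?sqr_ge0// divr_ge0//; lra.
Qed.

(** Both parts of the energy are nonnegative and bounded by its initial value 1/(p+1): the potential
    part gives |f| <= 1, the kinetic part f1^2 <= 2/(p+1) <= 1. *)
Lemma normalised_le1 M p L f f1 t : normalised M p L f f1 -> 0 <= t <= L ->
  `|f t| <= 1 /\ `|f1 t| <= 1.
Proof.
move=> nf tL; have := normalised_energy_le nf tL.
have [_ _ _ p1 _] := nf.
have p0 : 0 < (p + 1)^-1 by rewrite invr_gt0; lra.
have ph : (p + 1)^-1 <= 2^-1 by rewrite lef_pV2 ?posrE; lra.
rewrite /energy => h; have h1 := sqr_ge0 (f1 t); have h2 := phi_mul_ge0 p (f t).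
split.
  apply: (norm_le1 p1); rewrite -(ler_pM2l p0) mulr1; nra.
have h3 : 0 <= (p + 1)^-1 * (phi p (f t) * f t) by rewrite mulr_ge0// ltW.
rewrite -(@ler_pXn2r _ 2)// ?nnegrE// expr1n real_normK ?num_real//; lra.
Qed.

(** Since |f| <= 1, the source term is bounded by 1 and [damped_bound] applies. The linear bound
    makes f1/t harmless at the origin. *)
Lemma normalised_slope M p L f f1 t : normalised M p L f f1 -> 0 <= t <= L ->
  `|f1 t| <= t.
Proof.
move=> nf /andP[t0 tL].
have [[cf cf1 f10 _ df] f0 L0 p1 /andP[M2 M3]] := nf.
move: t0; rewrite le_eqVlt => /orP[/eqP <-|t0]; first by rewrite f10 normr0.
rewrite -[leRHS]mul1r.
apply: (@damped_bound R M L 1 f1 (fun s => phi p (f s))) => //; try lra.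
- by move=> s /df [].
- move=> s /andP[s0 sL]; have [h _] := @normalised_le1 _ _ _ _ _ s nf ltac:(rewrite !ltW//).
  by apply: (le_trans (norm_phi_le p1 h)); rewrite powR1 mul1r.
- apply: cont_onM => //; apply: cont_on_sub (powR_cont_on _).
    by move=> s /andP[].
  lra.
- by rewrite f10 mulr0.
Qed.

(** The damping term contributes at most M - 1 <= 2, because |f1| <= t, and the nonlinearity at most
    1. *)
Lemma normalised_second M p L f f1 t : normalised M p L f f1 -> 0 < t < L ->
  `|- ((M - 1) / t * f1 t) - phi p (f t)| <= 3.
Proof.
move=> nf /andP[t0 tL].
have tI : 0 <= t <= L by rewrite !ltW.
have [h _] := normalised_le1 nf tI; have h2 := normalised_slope nf tI.
have [_ _ L0 p1 /andP[M2 M3]] := nf.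
have h3 := norm_phi_le p1 h; rewrite powR1 mul1r in h3.
apply: (le_trans (ler_normB _ _)); rewrite normrN.
have -> : (M - 1) / t * f1 t = (M - 1) * (f1 t / t) by ring.
have h4 : `|f1 t / t| <= 1.
  by rewrite normrM normfV (gtr0_norm t0) ler_pdivrMr// mul1r.
rewrite normrM (@ger0_norm _ (M - 1)); last by lra.
have := normr_ge0 (f1 t / t); nra.
Qed.

Lemma normalised_lip M p L f f1 s t : normalised M p L f f1 ->
  0 <= s -> s <= t -> t <= L ->
  `|f t - f s| <= t - s /\ `|f1 t - f1 s| <= 3 * (t - s).
Proof.
move=> nf s0 st tL.
have [[cf cf1 _ _ df] _ L0 p1 _] := nf.
have sub : seg s t `<=` seg 0 L.
  by move=> x /andP[sx xt]; rewrite /seg /= (le_trans s0 sx) (le_trans xt).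
have inn x : s < x < t -> 0 < x < L.
  by move=> /andP[sx xt]; rewrite (le_lt_trans s0 sx) (lt_le_trans xt).
split.
  rewrite -[leRHS]mul1r; apply: (@deriv_bound R f f1 s t 1) => //.
  - exact: cont_on_sub cf.
  - by move=> x /inn /df[].
  - move=> x /inn /andP[x0 xL].
    by have [] := @normalised_le1 _ _ _ _ _ x nf ltac:(rewrite !ltW//).
apply: (deriv_bound st (cont_on_sub sub cf1) (fun x h => (df x (inn x h)).2)).
by move=> x /inn; exact: normalised_second.
Qed.

(** As f1 >= -t, the function f + t^2/2 is nondecreasing, so f(t) >= 1 - t^2/2. *)
Lemma normalised_half M p L f f1 t : normalised M p L f f1 -> 0 <= t <= L -> t <= 1 ->
  2^-1 <= f t.
Proof.
move=> nf /andP[t0 tL] t1.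
have [[cf cf1 _ _ df] f0 L0 p1 _] := nf.
have sub : seg 0 t `<=` seg 0 L.
  by move=> x /andP[sx xt]; rewrite /seg /= sx (le_trans xt).
suff : f 0 + 2^-1 * 0 ^+ 2 <= f t + 2^-1 * t ^+ 2 by rewrite f0; nra.
apply: (@deriv_ge0_le R (fun s => f s + 2^-1 * s ^+ 2) (fun s => f1 s + s) 0 t) => //.
- apply: cont_onD; first exact: cont_on_sub cf.
  by apply: cont_onM; [exact: cont_on_cst|apply: cont_onX; exact: cont_on_id].
- move=> x /andP[x0 xt]; have xL : 0 < x < L by rewrite x0 (lt_le_trans xt).
  apply: (derE (derD (df x xL).1 (der_scale 2^-1 (der_sqr (der_id x))))).
  by field.
- move=> x /andP[x0 xt]; have xL : 0 <= x <= L by lra.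
  have := normalised_slope nf xL; rewrite ler_norml => /andP[h _]; lra.
Qed.

Lemma normalised_len M p L f f1 : normalised M p L f f1 -> 1 < L.
Proof.
move=> nf; rewrite ltNge; apply/negP => L1.
have [[_ _ _ fL _] _ L0 _ _] := nf.
have := @normalised_half _ _ _ _ _ L nf; rewrite fL lexx (ltW L0) => /(_ isT L1); lra.
Qed.

Lemma normalised_zero_gt1 M p L f f1 x : normalised M p L f f1 -> 0 <= x <= L ->
  f x = 0 -> 1 < x.
Proof.
move=> nf xL fx; rewrite ltNge; apply/negP => x1.
have := normalised_half nf xL x1; rewrite fx; lra.
Qed.

Lemma energy_half_gt0 p : 1 < p -> 0 < @energy_half R p.
Proof.
move=> p1; rewrite /energy_half mulr_gt0 ?invr_gt0//; first by lra.
by rewrite mulr_gt0 ?invr_gt0// /phi mulr_gt0 ?invr_gt0// powR_gt0// normr_gt0 invr_neq0.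
Qed.

(** The derivative of t^4 E is t^3 (4 E - (M-1) f1^2), nonnegative because M <= 3. Comparing t = 1,
    where E >= [energy_half p], with a zero x, where E = f1^2/2, gives the bound. *)
Lemma normalised_zero_slope M p L f f1 x : normalised M p L f f1 -> 0 <= x <= L ->
  f x = 0 -> 2 * energy_half p <= f1 x ^+ 2 * x ^+ 4.
Proof.
move=> nf xL fx; have x1 := normalised_zero_gt1 nf xL fx.
have [em f0 L0 p1 /andP[M2 M3]] := nf.
have pV : 0 < (p + 1)^-1 by rewrite invr_gt0; lra.
have Lg := normalised_len nf; move: xL => /andP[x0 xL].
(* The fourth power is written as an iterated square so that [der_sqr] differentiates it. *)
set F := fun s => energy p f f1 s * (s ^+ 2) ^+ 2.
have F1 : energy_half p <= F 1.
  rewrite /F !expr1n mulr1 /energy_half /energy.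
  apply: ler_wpDl; first by rewrite mulr_ge0 ?sqr_ge0// invr_ge0.
  rewrite ler_pM2l//; apply: phi_mul_le => //.
  have h := @normalised_half _ _ _ _ _ 1 nf ltac:(rewrite ler01 ltW//) ltac:(exact: lexx).
  by rewrite !ger0_norm//; lra.
suff : F 1 <= F x.
  rewrite /F /energy fx mulr0 mulr0 addr0 => h.
  have -> : x ^+ 4 = (x ^+ 2) ^+ 2 by ring.
  by move: (le_trans F1 h) => {}h; nra.
apply: (@deriv_ge0_le R F (fun s => energy p f f1 s * (2 * s ^+ 2 * (2 * s * 1))
  + (s ^+ 2) ^+ 2 * (- ((M - 1) / s * f1 s ^+ 2))) 1 x).
- exact: ltW.
- apply: cont_onM; last by apply: cont_onX; apply: cont_onX; exact: cont_on_id.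
  apply: cont_on_sub (cont_energy p1 em) => s /andP[s1 sx].
  by rewrite /seg /= (le_trans _ s1)//= (le_trans sx).
- move=> s /andP[s1 sx].
  have sL : 0 < s < L by rewrite (lt_trans _ s1)//= (lt_le_trans sx).
  exact: (derM (der_energy p1 sL em) (der_sqr (der_sqr (der_id s)))).
- move=> s /andP[s1 sx].
  have s0 : 0 < s by lra.
  have -> : energy p f f1 s * (2 * s ^+ 2 * (2 * s * 1)) + (s ^+ 2) ^+ 2 * - ((M - 1) / s * f1 s ^+ 2)
    = s ^+ 3 * (4 * energy p f f1 s - (M - 1) * f1 s ^+ 2) by field; rewrite gt_eqF.
  rewrite mulr_ge0 ?exprn_ge0 ?(ltW s0)// /energy.
  have h1 : 0 <= (p + 1)^-1 * (phi p (f s) * f s) by rewrite mulr_ge0 ?phi_mul_ge0// ltW.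
  have h2 := sqr_ge0 (f1 s); nra.
Qed.

End Normalised.

(** * Comparison of two normalised solutions *)

Section Comparison.
Context {R : realType}.
Implicit Types (M p L s t : R) (f g : R -> R).

(** Here a and b are the differences of the profiles and of their slopes, k is the damping
    coefficient, e the error from the two dimensions and d the difference of the nonlinear terms.
    The damping has the good sign; the remaining products are split by 2xy <= x^2 + y^2. *)
Lemma gronwall_step (p k mu a b e d : R) : 1 < p -> 0 <= k -> `|e| <= `|mu| ->
  `|d| <= p * `|a| ->
  2 * a * b + 2 * b * (- (k * b) - e - d) <= (p + 2) * (a ^+ 2 + b ^+ 2) + mu ^+ 2.
Proof.
move=> p1 k0 emu dpa.
have h1 : e ^+ 2 <= mu ^+ 2.
  by rewrite -(real_normK (num_real e)) -(real_normK (num_real mu)) lerXn2r ?nnegrE.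
have h2 : - (b * d) <= p * (`|a| * `|b|).
  apply: (le_trans (ler_norm _)); rewrite normrN normrM.
  by rewrite mulrC mulrA ler_wpM2r.
have h3 : 2 * (`|a| * `|b|) <= a ^+ 2 + b ^+ 2.
  rewrite -(real_normK (num_real a)) -(real_normK (num_real b)).
  have := sqr_ge0 (`|a| - `|b|); rewrite sqrrB; lra.
have h4 := sqr_ge0 (a - b); have h5 := sqr_ge0 (b + e).
have h6 : 0 <= k * b ^+ 2 by rewrite mulr_ge0 ?sqr_ge0.
have h7 : 2 * (p * (`|a| * `|b|)) <= p * (a ^+ 2 + b ^+ 2).
  by rewrite mulrCA ler_pM2l//; lra.
have h8 := sqr_ge0 a.
have -> : 2 * a * b + 2 * b * (- (k * b) - e - d)
  = 2 * (a * b) - 2 * (k * b ^+ 2) - 2 * (b * e) + 2 * (- (b * d)) by ring.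
rewrite sqrrB in h4; rewrite sqrrD in h5; lra.
Qed.

(** The squared distance G satisfies G' <= (p+2) G + (M-N)^2 and G(0) = 0. Hence (M-N)^2 t - G
    exp(-(p+2) t), the function [W], is nondecreasing from 0. *)
Lemma gronwall M N p L1 L2 f f1 g g1 t :
  normalised M p L1 f f1 -> normalised N p L2 g g1 -> 0 <= t -> t <= L1 -> t <= L2 ->
  (f t - g t) ^+ 2 + (f1 t - g1 t) ^+ 2 <= (M - N) ^+ 2 * t * expR ((p + 2) * t).
Proof.
move=> nf ng t0 tL1 tL2.
have [[cf cf1 f10 _ df] f0 L10 p1 /andP[M2 M3]] := nf.
have [[cg cg1 g10 _ dg] g0 L20 _ /andP[N2 N3]] := ng.
set G := fun s => (f s - g s) ^+ 2 + (f1 s - g1 s) ^+ 2.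
set c := p + 2.
pose W s := (M - N) ^+ 2 * s - G s * expR (- c * s).
suff : W 0 <= W t.
  rewrite /W {1}/G f0 g0 f10 g10 !subrr expr0n addr0 mul0r mulr0 subr0 subr_ge0.
  by rewrite mulNr expRN ler_pdivrMr ?expR_gt0.
pose G' s := 2 * (f s - g s) * (f1 s - g1 s) + 2 * (f1 s - g1 s) *
  (- ((M - 1) / s * f1 s) - phi p (f s) - (- ((N - 1) / s * g1 s) - phi p (g s))).
have dE (s : R) : is_derive s 1 (fun s => expR (- c * s)) (expR (- c * s) * (- c * 1)).
  exact: (der_comp (is_derive_expR _) (der_scale _ (der_id _))).
have sub1 : seg 0 t `<=` seg 0 L1 by move=> s /andP[h1 h2]; apply/andP; split => //; exact: le_trans tL1.
have sub2 : seg 0 t `<=` seg 0 L2 by move=> s /andP[h1 h2]; apply/andP; split => //; exact: le_trans tL2.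
pose W' s := (M - N) ^+ 2 * 1 - (G s * (expR (- c * s) * (- c * 1)) + expR (- c * s) * G' s).
apply: (deriv_ge0_le (F' := W') t0).
- apply: cont_onB; first by apply: cont_onM; [exact: cont_on_cst|exact: cont_on_id].
  apply: cont_onM; last by apply: cont_onT => s; exact: (der_cont (dE s)).
  by apply: cont_onD; apply: cont_onX; apply: cont_onB;
    [exact: cont_on_sub cf|exact: cont_on_sub cg|exact: cont_on_sub cf1|exact: cont_on_sub cg1].
- move=> s /andP[s0 st].
  have [d1 d2] := df s ltac:(rewrite s0 (lt_le_trans st)//).
  have [e1 e2] := dg s ltac:(rewrite s0 (lt_le_trans st)//).
  have dG := derD (der_sqr (derB d1 e1)) (der_sqr (derB d2 e2)).
  have h := derB (der_scale ((M - N) ^+ 2) (der_id s)) (derM dG (dE s)).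
  exact: h.
- move=> s /andP[s0 st].
  have sL1 : 0 <= s <= L1 by rewrite ltW//= ltW// (lt_le_trans st).
  have sL2 : 0 <= s <= L2 by rewrite ltW//= ltW// (lt_le_trans st).
  have [hf _] := normalised_le1 nf sL1; have [hg _] := normalised_le1 ng sL2.
  have hd := phi_lip p1 hg hf; rewrite powR1 mulr1 in hd.
  (* The damping terms differ by (M-1)/s (f1-g1) + (M-N)/s g1; the bound |g1 s| <= s removes the
     singular factor of the second summand. *)
  have he : `|(M - N) / s * g1 s| <= `|M - N|.
    rewrite !normrM normfV (gtr0_norm s0) -mulrA ler_piMr//.
    by rewrite ler_pdivrMl// mulr1; exact: normalised_slope ng sL2.
  have k0 : 0 <= (M - 1) / s by rewrite divr_ge0 ?(ltW s0)//; lra.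
  have := gronwall_step (f1 s - g1 s) p1 k0 he hd.
  have -> : 2 * (f s - g s) * (f1 s - g1 s) + 2 * (f1 s - g1 s) *
    (- ((M - 1) / s * (f1 s - g1 s)) - (M - N) / s * g1 s - (phi p (f s) - phi p (g s)))
    = G' s by rewrite /G'; field; rewrite gt_eqF.
  rewrite -/c -/(G s) => h.
  have E0 := expR_gt0 (- c * s).
  have E1 : expR (- c * s) <= 1 by rewrite -expR0 ler_expR mulNr oppr_le0 mulr_ge0 ?(ltW s0)// /c; lra.
  have h' : expR (- c * s) * (G' s - c * G s) <= 1 * (M - N) ^+ 2.
    apply: (@le_trans _ _ (expR (- c * s) * (M - N) ^+ 2)).
      by rewrite ler_pM2l//; lra.
    by rewrite ler_wpM2r// sqr_ge0.
  rewrite /W'; lra.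
Qed.

(** The mean value theorem on each side of x gives g(x-eta) <= g(x) - c eta <= 0 <= g(x) + c eta <=
    g(x+eta). *)
Lemma zero_near_pos g g1 (x eta c : R) : 0 < eta -> 0 < c ->
  cont_on (seg (x - eta) (x + eta)) g ->
  (forall t, x - eta < t < x + eta -> is_derive t 1 g (g1 t)) ->
  (forall t, x - eta < t < x + eta -> c <= g1 t) ->
  `|g x| <= c * eta -> exists2 z, x - eta <= z <= x + eta & g z = 0.
Proof.
move=> e0 c0 cg dg gc; rewrite ler_norml => /andP[gx1 gx2].
have x1 : x - eta < x by lra.
have x2 : x < x + eta by lra.
apply: ivt0 => //; first lra.
have [|t h|t1 h1 E1] := @mean_value R g g1 (x - eta) x x1.
- by apply: cont_on_sub cg => s /andP[? ?]; apply/andP; lra.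
- by apply: dg; lra.
have [|t h|t2 h2 E2] := @mean_value R g g1 x (x + eta) x2.
- by apply: cont_on_sub cg => s /andP[? ?]; apply/andP; lra.
- by apply: dg; lra.
have := gc t1 ltac:(lra); have := gc t2 ltac:(lra) => k2 k1.
apply/andP; split; nra.
Qed.

(** The slope keeps its sign and stays at least c in modulus on the window; a negative slope is
    treated by changing the sign of g. *)
Lemma zero_near g g1 (x eta c : R) : 0 < eta -> 0 < c ->
  cont_on (seg (x - eta) (x + eta)) g ->
  (forall t, x - eta < t < x + eta -> is_derive t 1 g (g1 t)) ->
  2 * c <= `|g1 x| ->
  (forall t, x - eta < t < x + eta -> `|g1 t - g1 x| <= c) ->
  `|g x| <= c * eta -> exists2 z, x - eta <= z <= x + eta & g z = 0.
Proof.
move=> e0 c0 cg dg gx gc h.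
case: (leP 0 (g1 x)) => g0.
  rewrite (ger0_norm g0) in gx.
  apply: (zero_near_pos e0 c0 cg dg _ h) => t /gc; rewrite ler_norml; lra.
rewrite (ltr0_norm g0) in gx.
have [|t ht|t ht||z hz gz] := @zero_near_pos (fun t => -1 * g t) (fun t => -1 * g1 t) x eta c e0 c0.
- by apply: cont_onM => //; exact: cont_on_cst.
- exact: (der_scale _ (dg t ht)).
- by have := gc t ht; rewrite ler_norml; lra.
- by rewrite mulN1r normrN.
by exists z => //; move/eqP: gz; rewrite mulN1r oppr_eq0 => /eqP.
Qed.

End Comparison.

(** * Comparison of the lengths by counting zeros *)

Lemma card_setD1_lt (T : choiceType) (A : set T) (a : T) (m : nat) :
  (A #= `I_m)%card -> A a -> ~ (`I_m #<= A `\ a)%card.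
Proof.
move=> Am Aa h.
have fA : finite_set A by apply/finite_setP; exists m.
have := leq_card_fset_set (finite_setD _ fA) h.
rewrite fset_setD1// -(card_fset_set Am) (finmap.cardfsD1 a (fset_set A)).
by rewrite in_fset_set// mem_set// add1n ltnn.
Qed.

(** The end [L] is included: a nodal interval is counted by its right end, so m nodal sets
    correspond to m zeros. *)
Definition zeros {R : realType} (L : R) (f : R -> R) : set R :=
  [set x | 0 < x <= L /\ f x = 0].

Section Lengths.
Context {R : realType}.
Implicit Types (M N p L c eta eps : R) (f g : R -> R).

(** By Rolle f1 vanishes somewhere between x and y, and f1 is 3-Lipschitz. *)
Lemma zeros_separated M p L f f1 c x y : normalised M p L f f1 -> 0 < c ->
  0 <= x -> x < y -> y <= L -> f x = 0 -> f y = 0 -> c <= `|f1 x| -> c <= 3 * (y - x).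
Proof.
move=> nf c0 x0 xy yL fx fy cx.
have [[cf _ _ _ df] _ _ _ _] := nf.
have [|s h|s sxy E] := @mean_value R f f1 x y xy.
- by apply: cont_on_sub cf => s /andP[? ?]; apply/andP; lra.
- by apply: (df s _).1; lra.
have f1s : f1 s = 0.
  move/eqP: E; rewrite fx fy subrr eq_sym mulf_eq0 => /orP[/eqP//|/eqP]; lra.
have [_ h] := @normalised_lip _ _ _ _ _ _ x s nf x0 ltac:(lra) ltac:(lra).
by move: h; rewrite f1s sub0r normrN; lra.
Qed.

(** If L2 >= L1 + delta, each of the m zeros of f has a zero of g within eta, and these are distinct
    and lie before L2; with L2 itself g would have m + 1 zeros. The bound 12 eta < c keeps the
    variation of g1 on a window below c/4 and the windows disjoint; the bounds on eps give |g1 x| >=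
    c/2 and |g x| <= (c/4) eta at a zero x of f. *)
Lemma length_gap M N p L1 L2 f f1 g g1 (m : nat) c eta delta eps :
  normalised M p L1 f f1 -> normalised N p L2 g g1 ->
  (zeros L1 f #= `I_m)%card -> (zeros L2 g #= `I_m)%card ->
  0 < c -> (forall x, zeros L1 f x -> c <= `|f1 x|) ->
  0 < eta -> eta < 1 -> eta < delta -> 12 * eta < c ->
  eps <= c / 2 -> eps <= c * eta / 4 ->
  (forall x, 0 <= x <= L1 -> x <= L2 -> `|f x - g x| <= eps /\ `|f1 x - g1 x| <= eps) ->
  L2 < L1 + delta.
Proof.
move=> nf ng Zf Zg c0 fc e0 e1 ed ec ep1 ep2 close.
rewrite ltNge; apply/negP => gap.
have [[cg _ _ gL dg] _ L20 _ _] := ng.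
have near x : zeros L1 f x -> exists z, [/\ 0 < z < L2, g z = 0 & x - eta <= z <= x + eta].
  move=> Zx; have [/andP[x0 xL] fx] := Zx.
  have x1 := normalised_zero_gt1 nf (introT andP (conj (ltW x0) xL)) fx.
  have [h1 h2] := close x ltac:(lra) ltac:(lra).
  have h3 := fc x Zx.
  rewrite fx sub0r normrN in h1.
  have c4 : 0 < c / 4 by lra.
  have h4 : 2 * (c / 4) <= `|g1 x|.
    have := ler_normB (f1 x) (f1 x - g1 x).
    have -> : f1 x - (f1 x - g1 x) = g1 x by ring.
    have := lerB_dist (f1 x) (g1 x); lra.
  have [|s h|s h||z hz gz] := @zero_near R g g1 x eta (c / 4) e0 c4 _ _ h4.
  - by apply: cont_on_sub cg => s /andP[? ?]; apply/andP; lra.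
  - by apply: (dg s _).1; lra.
  - case: (leP s x) => sx.
      have [_ h'] := @normalised_lip _ _ _ _ _ _ s x ng ltac:(lra) sx ltac:(lra).
      by rewrite distrC; lra.
    have [_ h'] := @normalised_lip _ _ _ _ _ _ x s ng ltac:(lra) ltac:(lra) ltac:(lra); lra.
  - lra.
  - by exists z; split => //; lra.
have /choice[h hP] : forall x, exists z, zeros L1 f x ->
    [/\ 0 < z < L2, g z = 0 & x - eta <= z <= x + eta].
  move=> x; have [Zx|nZx] := pselect (zeros L1 f x); last by exists 0.
  by have [z hz] := near x Zx; exists z.
(* Zeros of f with the same image are at most 2 eta apart, which is less than the separation c/3. *)
have hinj : {in zeros L1 f &, injective h}.
  have sep x y : zeros L1 f x -> zeros L1 f y -> x < y -> h x <> h y.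
    move=> Zx Zy xy exy; have [_ _ hx] := hP x Zx; have [_ _ hy] := hP y Zy.
    have [/andP[x0 _] fx] := Zx; have [/andP[_ yL] fy] := Zy.
    have := zeros_separated nf c0 (ltW x0) xy yL fx fy (fc x Zx).
    rewrite exy in hx; lra.
  move=> x y /set_mem Zx /set_mem Zy hxy.
  by case: (ltgtP x y) => // xy; [case: (sep x y)|case: (sep y x)].
have ZL : zeros L2 g L2 by split => //; rewrite L20 lexx.
apply: (card_setD1_lt Zg ZL).
have hsub : h @` zeros L1 f `<=` zeros L2 g `\ L2.
  move=> _ [x Zx <-]; have [/andP[z0 zL] gz _] := hP x Zx; split.
    by split => //; rewrite z0 ltW.
  by move=> /= E; move: zL; rewrite E ltxx.
apply: (card_le_trans _ (subset_card_le hsub)).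
rewrite -(card_le_eql Zf).
by move/card_eqPle: (inj_card_eq hinj) => [].
Qed.

Lemma sqr_norm_le (a b e : R) : 0 <= e -> a ^+ 2 + b ^+ 2 <= e ^+ 2 ->
  `|a| <= e /\ `|b| <= e.
Proof.
move=> e0 h; have h1 := sqr_ge0 a; have h2 := sqr_ge0 b.
by split; rewrite -(@ler_pXn2r _ 2)// ?nnegrE// real_normK ?num_real//; lra.
Qed.

(** For M close to N, Gronwall makes the profiles C^1-close on the common interval, and
    [length_gap], applied from the shorter profile to the longer one, controls the lengths. *)
Lemma normalised_close N p l g g1 (m : nat) (delta : R) :
  normalised N p l g g1 -> (zeros l g #= `I_m)%card -> 0 < delta ->
  exists2 e, 0 < e & forall M L f f1, normalised M p L f f1 ->
    (zeros L f #= `I_m)%card -> `|M - N| <= e ->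
    `|L - l| < delta /\
    forall t, 0 <= t <= L -> t <= l -> `|f t - g t| < delta /\ `|f1 t - g1 t| < delta.
Proof.
move=> ng Zg d0.
have [_ _ _ p1 _] := ng.
have l1 := normalised_len ng.
have E0 := energy_half_gt0 p1.
have l4 : 0 < l ^+ 4 by rewrite exprn_gt0//; lra.
set c2 := 2 * energy_half p / l ^+ 4.
have c20 : 0 < c2 by rewrite divr_gt0//; lra.
pose c := Num.sqrt c2.
have c0 : 0 < c by rewrite sqrtr_gt0.
(* For zeros x <= l, the factor x^4 in [normalised_zero_slope] is at most l^4, so c does not depend
   on the profile. In either order of the lengths, all zeros of the shorter profile satisfy x <=
   l. *)
have slope K L f f1 x : normalised K p L f f1 -> zeros L f x -> x <= l -> c <= `|f1 x|.
  move=> nf [/andP[x0 xL] fx] xl.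
  have h := normalised_zero_slope nf (introT andP (conj (ltW x0) xL)) fx.
  have cn : 0 <= c by exact: ltW.
  rewrite -(@ler_pXn2r _ 2)// ?nnegrE// real_normK ?num_real//.
  rewrite sqr_sqrtr ?(ltW c20)// /c2 ler_pdivrMr//; apply: (le_trans h).
  by rewrite ler_wpM2l ?sqr_ge0// lerXn2r ?nnegrE//; lra.
pose eta := Num.min (Num.min (1 / 2) (delta / 2)) (c / 24).
have e0 : 0 < eta by rewrite !lt_min; lra.
have [eA [eB eC]] : eta <= 1 / 2 /\ eta <= delta / 2 /\ eta <= c / 24.
  by rewrite /eta !ge_min; split; [|split]; rewrite lexx ?orbT.
pose eps := Num.min (Num.min (c / 2) (c * eta / 4)) (delta / 2).
have ce0 : 0 < c * eta by exact: mulr_gt0.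
have ep0 : 0 < eps by rewrite !lt_min; lra.
have [epA [epB epC]] : eps <= c / 2 /\ eps <= c * eta / 4 /\ eps <= delta / 2.
  by rewrite /eps !ge_min; split; [|split]; rewrite lexx ?orbT.
(* For t <= l the Gronwall bound is at most (M-N)^2 K, hence at most eps^2 once |M-N| <= eps / sqrt
   K. *)
set K := l * expR ((p + 2) * l).
have K0 : 0 < K by rewrite mulr_gt0 ?expR_gt0//; lra.
exists (eps / Num.sqrt K); first by rewrite divr_gt0 ?sqrtr_gt0.
move=> M L f f1 nf Zf MN.
have close t : 0 <= t <= L -> t <= l -> `|f t - g t| <= eps /\ `|f1 t - g1 t| <= eps.
  move=> /andP[t0 tL] tl; apply: sqr_norm_le; first exact: ltW.
  apply: (le_trans (gronwall nf ng t0 tL tl)).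
  have h1 : (M - N) ^+ 2 <= eps ^+ 2 / K.
    rewrite -(real_normK (num_real (M - N))).
    have -> : eps ^+ 2 / K = (eps / Num.sqrt K) ^+ 2 by rewrite expr_div_n sqr_sqrtr ?ltW.
    by rewrite lerXn2r ?nnegrE// ltW// divr_gt0 ?sqrtr_gt0.
  have h2 : t * expR ((p + 2) * t) <= K.
    apply: ler_pM; rewrite ?expR_ge0//.
    by rewrite ler_expR ler_wpM2l//; lra.
  rewrite -mulrA; apply: (@le_trans _ _ (eps ^+ 2 / K * K)); last by rewrite divfK// gt_eqF.
  by apply: ler_pM => //; rewrite ?sqr_ge0// mulr_ge0 ?expR_ge0.
split; last by move=> t h1 h2; have [h3 h4] := close t h1 h2; split; lra.
rewrite ltr_norml; apply/andP; split; case: (leP l L) => lL; try lra.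
- suff : l < L + delta by lra.
  apply: (length_gap nf ng Zf Zg c0 _ e0 _ _ _ epA epB close); try lra.
  by move=> x Zx; apply: (slope _ _ _ _ _ nf Zx); case: Zx => /andP[]; lra.
- suff : L < l + delta by lra.
  apply: (length_gap ng nf Zg Zf c0 _ e0 _ _ _ epA epB); try lra.
    by move=> x Zx; apply: (slope _ _ _ _ _ ng Zx); case: Zx => /andP[].
  move=> x /andP[x0 xl] xL; rewrite !(distrC (g _)) !(distrC (g1 _)).
  by apply: close => //; rewrite x0.
Qed.

End Lengths.

(** * Counting nodal sets *)

(** Choosing a representative in each fibre of [F] and applying [G] to it is a bijection between the
    images. *)
Lemma card_image_ker (T U V : Type) (A : set T) (F : T -> U) (G : T -> V) :
  (forall x y, A x -> A y -> F x = F y <-> G x = G y) ->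
  (F @` A #= G @` A)%card.
Proof.
move=> FG.
have [[x0 Ax0]|nA] := pselect (exists x, A x); last first.
  have -> : A = set0 by apply/seteqP; split => // x Ax; apply: nA; exists x.
  by rewrite !image_set0.
have /choice[s sP] : forall X, exists x, (F @` A) X -> A x /\ F x = X.
  move=> X; have [[x Ax <-]|h] := pselect ((F @` A) X); first by exists x.
  by exists x0.
have inj : {in F @` A &, injective (G \o s)}.
  move=> X Y /set_mem hX /set_mem hY /= e.
  have [aX <-] := sP X hX; have [aY <-] := sP Y hY.
  exact/(FG _ _ aX aY).
rewrite card_eq_sym (_ : G @` A = (G \o s) @` (F @` A)); first exact: inj_card_eq inj.
apply/seteqP; split.
  move=> _ [x Ax <-]; exists (F x); first by exists x.
  have [a e] := sP (F x) (ex_intro2 _ _ x Ax erefl).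
  exact/(FG _ _ a Ax).
move=> _ [X hX <-]; have [a e] := sP X hX.
by exists (s X).
Qed.

Section Nodal.
Context {R : realType}.
Implicit Types (f : R -> R) (r x y z : R).

(** The right end of the nodal component of r, used as a label of that component. *)
Definition next_zero f r z : Prop :=
  [/\ r < z, z <= 1, f z = 0 & forall s, r <= s < z -> f s != 0].

Lemma next_zero_uniq f r z z' : next_zero f r z -> next_zero f r z' -> z = z'.
Proof.
move=> [rz z1 fz h] [rz' z1' fz' h'].
case: (ltgtP z z') => // zz.
  by have := h' z; rewrite (ltW rz) zz fz eqxx => /(_ isT).
by have := h z'; rewrite (ltW rz') zz fz' eqxx => /(_ isT).
Qed.

(** The infimum of the zeros to the right of r, a set containing 1; continuity makes the infimum a
    zero. *)
Lemma next_zero_exists f r : cont_on (seg 0 1) f -> f 1 = 0 -> nodal_radii f r ->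
  exists z, next_zero f r z.
Proof.
move=> cf f1 [/andP[r0 r1] fr].
pose S := [set z | r < z <= 1 /\ f z = 0].
have S1 : S 1 by split => //; rewrite r1 lexx.
have lb z : S z -> r <= z by move=> [/andP[/ltW]].
have hS : has_inf S by split; [exists 1|exists r].
set i := inf S.
have i1 : i <= 1 by apply: ge_inf => //; exists r.
have ri : r <= i by apply: lb_le_inf => //; exists 1.
have fi : f i = 0.
  apply/eqP/negPn/negP => fi.
  have iI : seg 0 1 i by apply/andP; split => //; exact: le_trans ri.
  have /(@cvgrPdistC_lt _ R) h := cf i iI.
  have n0 : 0 < `|f i| by rewrite normr_gt0.
  have /nbhs_ballP [d /= d0 hd] := h _ n0.
  have [z Sz zi] := inf_adherent d0 hS.
  have iz : i <= z by apply: ge_inf => //; exists r.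
  have [/andP[rz z1] fz] := Sz.
  have bz : ball i d z by rewrite /ball /= distrC ger0_norm ?subr_ge0//; rewrite -/i in zi; lra.
  have zI : seg 0 1 z by apply/andP; split => //; lra.
  by have := hd z bz zI; rewrite fz sub0r normrN ltxx.
have ri' : r < i by rewrite lt_neqAle ri andbT; apply: contraNneq fr => ->; rewrite fi.
exists i; split => // s /andP[rs si].
apply/eqP => fs.
have rs' : r < s by rewrite lt_neqAle rs andbT; apply: contraNneq fr => ->; rewrite fs.
have : i <= s by apply: ge_inf; [exists r|split => //; rewrite rs' (le_trans (ltW si))].
by rewrite leNgt si.
Qed.

(** Connected subsets of the line are intervals. If the components agree, no zero lies between r and
    r', so the next zeros agree; if the next zeros agree, the segment from r to r' is free of zeros
    and lies in one component. *)
Lemma nodal_component_eq f r r' z z' : nodal_radii f r -> nodal_radii f r' ->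
  next_zero f r z -> next_zero f r' z' ->
  connected_component (nodal_radii f) r = connected_component (nodal_radii f) r' <-> z = z'.
Proof.
wlog rr : r r' z z' / r <= r'.
  move=> h Ar Ar' nz nz'; case: (leP r r') => [le|/ltW le]; first exact: h.
  by have H := h r' r z' z le Ar' Ar nz' nz; split => [/esym/H|/esym/H].
move=> Ar Ar' nz nz'; split => [CC|zz].
  have sub s : r <= s <= r' -> f s != 0.
    move=> rs; have : connected_component (nodal_radii f) r s.
      have itv := (connected_intervalP _).1 (@component_connected _ (nodal_radii f) r).
      apply: (itv r r' _ _ s rs).
        exact: connected_component_refl.
      by rewrite CC; exact: connected_component_refl.
    by move/connected_component_sub => [].
  apply: (next_zero_uniq (f := f) (r := r)) => //.
  have [h1 h2 h3 h4] := nz'; split => //; first exact: le_lt_trans h1.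
  move=> s /andP[rs sz]; case: (leP s r') => sr; first by apply: sub; rewrite rs.
  by apply: h4; rewrite (ltW sr).
apply: same_connected_component.
have [h1 h2 h3 h4] := nz; have [k1 _ _ _] := nz'.
apply: (@connected_component_max _ (nodal_radii f) `[r, r'] r _ _ (@segment_connected R r r')).
- by rewrite /= in_itv /= lexx.
- move=> s; rewrite /= in_itv /= => /andP[rs sr].
  have [/andP[r0 _] _] := Ar; have [/andP[_ r1] _] := Ar'.
  split; first by rewrite (le_trans r0)//= (le_lt_trans sr).
  by apply: h4; rewrite rs zz (le_lt_trans sr).
- by rewrite /= in_itv /= rr lexx.
Qed.

(** Sending a component to its right end is injective by [nodal_component_eq]. It reaches every zero
    because each one has a zero-free interval immediately to its left. *)
Lemma nodal_zeros f (m : nat) : cont_on (seg 0 1) f -> f 1 = 0 ->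
  (forall x, zeros 1 f x -> exists2 y, 0 <= y < x & forall s, y <= s < x -> f s != 0) ->
  has_n_nodal_sets f m -> (zeros 1 f #= `I_m)%card.
Proof.
move=> cf f1 iso; rewrite /has_n_nodal_sets.
have /choice[n nP] : forall r, exists z, nodal_radii f r -> next_zero f r z.
  move=> r; have [Ar|nAr] := pselect (nodal_radii f r); last by exists 0.
  by have [z hz] := next_zero_exists cf f1 Ar; exists z.
have ker x y : nodal_radii f x -> nodal_radii f y ->
    connected_component (nodal_radii f) x = connected_component (nodal_radii f) y <-> n x = n y.
  by move=> Ax Ay; apply: nodal_component_eq => //; exact: nP.
rewrite (card_eql (card_image_ker ker)).
suff -> : n @` nodal_radii f = zeros 1 f by [].
apply/seteqP; split.
  move=> _ [r Ar <-]; have [h1 h2 h3 _] := nP r Ar; have [/andP[r0 _] _] := Ar.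
  by split => //; rewrite h2 (le_lt_trans r0).
move=> x Zx; have [y /andP[y0 yx] h] := iso x Zx; have [/andP[x0 x1] fx] := Zx.
have Ay : nodal_radii f y by split; [rewrite y0 (lt_le_trans yx)|apply: h; rewrite lexx].
by exists y => //; apply: (next_zero_uniq (nP y Ay)).
Qed.

End Nodal.

(** * One-sided derivatives *)

Section HasDerivOn.
Context {R : realType}.
Implicit Types (A B : set R) (f g : R -> R).

(** The filter occurring in [has_deriv_on], named so that a [Filter] instance can be attached to
    it. *)
Definition punctured A (x : R) : set_system R := within A (nbhs x^').

#[global] Instance punctured_filter A x : Filter (punctured A x).
Proof. exact: within_filter. Qed.

Lemma punctured_near A (x : R) (P : R -> Prop) :
  (\forall y \near nbhs x, y != x -> A y -> P y) -> \forall y \near punctured A x, P y.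
Proof. by []. Qed.

Lemma punctured_sub_within A (x : R) : punctured A x --> within A (nbhs x).
Proof. by move=> P; rewrite /punctured /within /=; apply: (@filterS _ (nbhs x)) => y h _. Qed.

Lemma punctured_cvg_eq A (x l : R) f g : (\forall y \near punctured A x, f y = g y) ->
  f @ punctured A x --> l -> g @ punctured A x --> l.
Proof.
move=> fg h; apply: cvg_trans h; apply: near_eq_cvg.
by apply: filterS fg => y ->.
Qed.

Lemma has_deriv_on_cont A f f1 : has_deriv_on A f f1 -> cont_on A f.
Proof.
move=> df x Ax.
have hid : (fun y => y - x) @ punctured A x --> x - x.
  apply: cvgB; last exact: cvg_cst.
  by move=> P hP; apply: punctured_near; apply: (@filterS _ (nbhs x)) hP => y Py.
have h : (fun y => f x + (f y - f x) / (y - x) * (y - x)) @ punctured A x --> f x.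
  rewrite -[X in _ --> X]addr0 -[X in _ --> _ + X](mulr0 (f1 x)) -(subrr x).
  exact: (cvgD (cvg_cst (f x)) (cvgM (df x Ax) hid)).
apply/(@cvgrPdistC_lt _ R) => e e0.
have /(@cvgrPdistC_lt _ R) /(_ e e0) := h.
rewrite /punctured /within /=; apply: (@filterS _ (nbhs x)) => y hy Ay.
case: (eqVneq y x) => [->|yx]; first by rewrite subrr normr0.
have := hy yx Ay; rewrite divfK ?subr_eq0//.
by have -> : f x + (f y - f x) = f y by ring.
Qed.

(** Injectivity of k keeps k y away from k x for y != x, so the difference quotient factors through
    k. *)
Lemma has_deriv_on_comp A B f f1 k k1 : has_deriv_on A f f1 -> has_deriv_on B k k1 ->
  (forall t, B t -> A (k t)) -> {in B &, injective k} ->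
  has_deriv_on B (f \o k) (fun t => f1 (k t) * k1 t).
Proof.
move=> df dk kBA inj x Bx.
have kc := has_deriv_on_cont dk Bx.
have neq : \forall y \near punctured B x, k y != k x.
  apply: punctured_near; near=> y => yx By.
  by apply: contraNneq yx => /inj -> //; exact: mem_set.
have inB : \forall y \near punctured B x, B y.
  by apply: punctured_near; apply: nearW.
have kp : k @ punctured B x --> punctured A (k x).
  move=> P hP.
  have h1 : \forall y \near within B (nbhs x), k y != k x -> A (k y) -> P (k y) by exact: (kc _ hP).
  have h2 := punctured_sub_within h1.
  have h3 : \forall y \near punctured B x, P (k y).
    near=> y; have By : B y by near: y.
    by apply: (near h2 y) => //; [near: y|exact: kBA].
  exact: h3.
have h1 : (fun y => (f (k y) - f (k x)) / (k y - k x)) @ punctured B x --> f1 (k x).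
  have h := df (k x) (kBA x Bx).
  exact: (@cvg_comp _ _ _ k (fun z => (f z - f (k x)) / (z - k x)) _ (punctured A (k x)) _ kp h).
have h2 := cvgM (FF := punctured_filter B x) h1 (dk x Bx).
suff h3 : (fun y => (f (k y) - f (k x)) / (y - x)) @ punctured B x --> f1 (k x) * k1 x.
  exact: h3.
apply: (punctured_cvg_eq _ h2); near=> y.
have nk : k y - k x != 0 by rewrite subr_eq0; near: y.
by rewrite /= mulrA divfK.
Unshelve. all: by end_near. Qed.

Lemma has_deriv_on_mul A f f1 g g1 : has_deriv_on A f f1 -> has_deriv_on A g g1 ->
  has_deriv_on A (fun t => f t * g t) (fun t => f1 t * g t + f t * g1 t).
Proof.
move=> df dg x Ax.
have gc : g @ punctured A x --> g x.
  exact: cvg_trans (cvg_app g (@punctured_sub_within A x)) (has_deriv_on_cont dg Ax).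
have h : (fun y => (f y - f x) / (y - x) * g y + f x * ((g y - g x) / (y - x)))
    @ punctured A x --> f1 x * g x + f x * g1 x.
  apply: cvgD; apply: cvgM => //; [exact: df|exact: cvg_cst|exact: dg].
suff h3 : (fun y => (f y * g y - f x * g x) / (y - x)) @ punctured A x --> f1 x * g x + f x * g1 x.
  exact: h3.
by apply: (punctured_cvg_eq _ h); apply: nearW => y; ring.
Qed.

Lemma has_deriv_on_cst A (c : R) : has_deriv_on A (fun=> c) (fun=> 0).
Proof.
move=> x Ax; suff h3 : (fun y => (c - c) / (y - x)) @ punctured A x --> 0 by exact: h3.
apply: (@punctured_cvg_eq _ _ _ (fun=> 0)); last exact: cvg_cst.
by apply: nearW => y; rewrite subrr mul0r.
Qed.

Lemma has_deriv_on_scale A (c : R) f f1 : has_deriv_on A f f1 ->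
  has_deriv_on A (fun t => c * f t) (fun t => c * f1 t).
Proof.
move=> df x Ax; have := has_deriv_on_mul (@has_deriv_on_cst A c) df Ax.
by rewrite /= mul0r add0r.
Qed.

Lemma has_deriv_on_eq_near A B f f1 g (x : R) : has_deriv_on A f f1 -> A x ->
  (\forall y \near nbhs x, B y -> A y) -> (forall y, A y -> f y = g y) ->
  (fun y => (g y - g x) / (y - x)) @ punctured B x --> f1 x.
Proof.
move=> df Ax BA fg; have h := df x Ax.
have fg' : \forall y \near punctured A x, (f y - f x) / (y - x) = (g y - g x) / (y - x).
  by apply: punctured_near; apply: nearW => y _ Ay; rewrite !fg.
move=> P /(punctured_cvg_eq fg' h) => hP.
have hP' : nbhs x (fun y => y != x -> A y -> P ((g y - g x) / (y - x))) by exact: hP.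
apply: punctured_near; near=> y => yx By.
have Ay : A y by apply: (near BA y).
by apply: (near hP' y).
Unshelve. all: by end_near. Qed.

Lemma has_deriv_on_of_der A f f1 : (forall x, A x -> is_derive x 1 f (f1 x)) -> has_deriv_on A f f1.
Proof.
move=> df x Ax; have /is_derive1_caratheodory[g [fg cg gx]] := df x Ax.
suff h : (fun y => (f y - f x) / (y - x)) @ punctured A x --> f1 x by exact: h.
apply: (@punctured_cvg_eq _ _ _ g).
  by apply: punctured_near; apply: nearW => y yx _; rewrite fg mulfK// subr_eq0.
rewrite -gx => P hP; apply: punctured_near.
by apply: (@filterS _ (nbhs x)) (cg _ hP) => y Py.
Qed.

(** The Carathéodory slope function is the difference quotient completed by [f1 x] at x. *)
Lemma der_of_hdo A f f1 (x : R) : has_deriv_on A f f1 -> A x ->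
  (\forall y \near nbhs x, A y) -> is_derive x 1 f (f1 x).
Proof.
move=> df Ax nA; apply/is_derive1_caratheodory.
exists (fun z => if z == x then f1 x else (f z - f x) / (z - x)).
rewrite eqxx; split => //.
  move=> z; case: eqVneq => [->|zx]; first by rewrite !subrr mulr0.
  by rewrite divfK// subr_eq0.
move=> P; rewrite eqxx => hP.
have h : nbhs x (fun y => y != x -> A y -> P ((f y - f x) / (y - x))) by exact: (df x Ax P hP).
suff : nbhs x (fun y => P (if y == x then f1 x else (f y - f x) / (y - x))) by [].
near=> y.
case: eqVneq => [_|yx]; first exact: nbhs_singleton hP.
by apply: (near h y) => //; near: y.
Unshelve. all: by end_near. Qed.

Lemma near_seg (a b x : R) : a < x < b -> \forall y \near nbhs x, seg a b y.
Proof.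
move=> /andP[ax xb]; have d0 : 0 < Num.min (x - a) (b - x) by rewrite lt_min !subr_gt0 ax xb.
apply/nbhs_ballP; exists (Num.min (x - a) (b - x)) => // y.
rewrite /ball /= lt_min !ltr_norml => /andP[/andP[? ?] /andP[? ?]].
by apply/andP; split; lra.
Qed.

(** At another zero the difference quotient would be 0, at distance |f1 x| from its limit. *)
Lemma has_deriv_on_simple_zero A f f1 (x : R) : has_deriv_on A f f1 -> A x -> f x = 0 -> f1 x != 0 ->
  exists2 d, 0 < d & forall y, A y -> `|x - y| < d -> y != x -> f y != 0.
Proof.
move=> df Ax fx f1x.
have n0 : 0 < `|f1 x| by rewrite normr_gt0.
have hf : (fun y => (f y - f x) / (y - x)) @ punctured A x --> f1 x := df x Ax.
have /(@cvgrPdistC_lt _ R) /(_ _ n0) /nbhs_ballP[d /= d0 hd] := hf.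
exists d => // y Ay yd yx; apply/eqP => fy.
by have := hd y yd yx Ay; rewrite fx fy subrr mul0r sub0r normrN ltxx.
Qed.

Lemma has_deriv_on_zeros_isolated f f1 : has_deriv_on (@I01 R) f f1 ->
  (forall x, zeros 1 f x -> f1 x != 0) ->
  forall x, zeros 1 f x -> exists2 y, 0 <= y < x & forall s, y <= s < x -> f s != 0.
Proof.
move=> df simple x Zx; have [/andP[x0 x1] fx] := Zx.
have Ix : I01 x by rewrite /I01 /= (ltW x0).
have [d d0 hd] := has_deriv_on_simple_zero df Ix fx (simple x Zx).
have y0 : 0 <= Num.max 0 (x - d / 2) by rewrite le_max lexx.
have y1 : x - d / 2 <= Num.max 0 (x - d / 2) by rewrite le_max lexx orbT.
exists (Num.max 0 (x - d / 2)); first by rewrite y0 gt_max x0; lra.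
move=> s /andP[ys sx]; apply: hd.
- by apply/andP; split; lra.
- by rewrite ger0_norm; lra.
- by rewrite lt_eqF.
Qed.

End HasDerivOn.

(** * The change of variable *)

Section ChangeOfVariable.
Context {R : realType}.
Implicit Types (N M p a c k t : R) (u v : R -> R).

Lemma powRDpos (t r s : R) : 0 < t -> t `^ (r + s) = t `^ r * t `^ s.
Proof. by move=> t0; rewrite powRD// (gt_eqF t0) implybT. Qed.

Lemma powRSpos (t r : R) : 0 < t -> t `^ (r + 1) = t `^ r * t.
Proof. by move=> t0; rewrite powRDpos// powRr1// ltW. Qed.

Lemma cont_zero_end (H : R -> R) : cont_on (seg 0 1) H ->
  (forall r, 0 < r < 1 -> H r = 0) -> H 1 = 0.
Proof.
move=> cH h0; apply/eqP/negPn/negP => H1.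
have I1 : seg 0 1 (1 : R) by apply/andP; split; rewrite ?ler01.
have /(@cvgrPdistC_lt _ R) h := cH 1 I1.
have n0 : 0 < `|H 1| by rewrite normr_gt0.
have /nbhs_ballP [d /= d0 hd] := h _ n0.
pose s := Num.max (1 - d / 2) (1 / 2).
have s1 : 1 - d / 2 <= s by rewrite le_max lexx.
have s2 : 1 / 2 <= s by rewrite le_max lexx orbT.
have s3 : s < 1 by rewrite gt_max; lra.
have bs : ball (1 : R) d s by rewrite /ball /= ger0_norm; lra.
have Is : seg 0 1 s by apply/andP; lra.
by have := hd s bs Is; rewrite h0 ?sub0r ?normrN ?ltxx//; lra.
Qed.

Lemma has_deriv_on_ext (A : set R) u u1 v1 : has_deriv_on A u u1 ->
  (forall x, A x -> u1 x = v1 x) -> has_deriv_on A u v1.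
Proof. by move=> du e x Ax; rewrite -e//; exact: du. Qed.

(** Continuity extends the equation to r = 1, as needed for the second derivative of the transformed
    function on the half-open interval. *)
Lemma radial_ode_end N a p u u1 u2 : 1 < p ->
  has_deriv_on I01 u u1 -> has_deriv_on I01 u1 u2 -> {within I01, continuous u2} ->
  u 1 = 0 ->
  (forall r, 0 < r < 1 -> - (u2 r + (N - 1) / r * u1 r) = r `^ a * (`|u r| `^ (p - 1) * u r)) ->
  forall r, 0 < r <= 1 -> u2 r = - ((N - 1) / r * u1 r) - r `^ a * phi p (u r).
Proof.
move=> p1 du du1 /cont_onP cu2 uE ode r /andP[r0].
have ode' s : 0 < s < 1 -> u2 s = - ((N - 1) / s * u1 s) - s `^ a * phi p (u s).
  by move=> /ode h; rewrite /phi -h; ring.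
rewrite le_eqVlt => /orP[/eqP -> {r r0}|r1]; last by apply: ode'; rewrite r0.
(* Multiplying by a large power of [s] makes every term continuous on the whole of [0, 1]. *)
have cu := has_deriv_on_cont du; have cu1 := has_deriv_on_cont du1.
have cphi : cont_on (seg 0 1) (fun s => phi p (u s)).
  by apply: (@cont_on_comp _ _ setT u (phi p)) => //; apply: cont_onT; exact: phi_cont.
have cpow : cont_on (seg 0 1) (fun s : R => s `^ (`|a| + 1)).
  apply: cont_on_sub (powR_cont_on _); first by move=> s /andP[].
  by rewrite ltr_wpDl.
have cpow2 : cont_on (seg 0 1) (fun s : R => s `^ (`|a| + 1 + a + 1)).
  apply: cont_on_sub (powR_cont_on _); first by move=> s /andP[].
  by have := ler_norm (- a); rewrite normrN; lra.
pose H s := s `^ (`|a| + 1) * s * u2 s + s `^ (`|a| + 1) * ((N - 1) * u1 s)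
  + s `^ (`|a| + 1 + a + 1) * phi p (u s).
have : H 1 = 0.
  apply: cont_zero_end.
    apply: cont_onD; last exact: cont_onM.
    apply: cont_onD; first by apply: cont_onM => //; apply: cont_onM => //; exact: cont_on_id.
    by apply: cont_onM => //; apply: cont_onM => //; exact: cont_on_cst.
  move=> s /[dup] /andP[s0 s1] /ode' e; rewrite /H e.
  have -> : s `^ (`|a| + 1 + a + 1) = s `^ (`|a| + 1) * (s `^ a * s).
    by rewrite powRSpos// powRDpos// mulrA.
  by field; rewrite gt_eqF.
rewrite /H !powR1 uE phi0 !mulr0 addr0 !mul1r divr1 subr0 => h; lra.
Qed.

Definition kap a : R := 2 / (a + 2).

(* The effective dimension M = 2(N+a)/(a+2). *)
Definition dimM N a : R := 2 + kap a * (N - 2).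

Definition vfun a p u t : R := kap a `^ (2 / (p - 1)) * u (t `^ kap a).

Definition vfun1 a p u1 t : R :=
  kap a `^ (2 / (p - 1)) * (u1 (t `^ kap a) * (kap a * t `^ (kap a - 1))).

(** Given by the limit-type equation rather than by differentiation; [has_deriv_on_vfun1] proves
    that it is the derivative of [vfun1]. *)
Definition vfun2 N a p u u1 t : R :=
  - ((dimM N a - 1) / t * vfun1 a p u1 t) - phi p (vfun a p u t).

Lemma kap_gt0 a : 0 < a -> 0 < kap a < 1.
Proof. by move=> a0; rewrite /kap divr_gt0 ?ltr_pdivrMr; lra. Qed.

(** The origin is left out because t^k with 0 < k < 1 is not differentiable there. *)
Definition I01oc : set R := [set t | 0 < t <= 1].

Lemma powR_I01 a t : 0 < a -> I01 t -> I01 (t `^ kap a).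
Proof.
move=> a0 /andP[t0 t1]; have /andP[k0 _] := kap_gt0 a0.
apply/andP; split; first exact: powR_ge0.
have := @ge0_ler_powR R (kap a) (ltW k0) t 1; rewrite !nnegrE powR1 => h.
by apply: h => //; exact: ler01.
Qed.

Lemma powR_I0 a t : 0 < a -> I01oc t -> I01oc (t `^ kap a).
Proof.
move=> a0 /andP[t0 t1]; apply/andP; split; first exact: powR_gt0.
have : I01 t by rewrite /I01 /= (ltW t0).
by move/(powR_I01 a0) => /andP[].
Qed.

Lemma has_deriv_on_powR (k : R) : has_deriv_on I01oc (fun t : R => t `^ k) (fun t => k * t `^ (k - 1)).
Proof. by apply: has_deriv_on_of_der => t /andP[t0 _]; exact: is_derive1_powR. Qed.

Lemma powR_inj0 (k : R) : 0 < k -> {in I01oc &, injective (fun t : R => t `^ k)}.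
Proof.
move=> k0 x y /set_mem /andP[x0 _] /set_mem /andP[y0 _].
by apply: powR_injective => //; rewrite nnegrE ltW.
Qed.

Lemma has_deriv_on_powR_comp a u u1 : 0 < a -> has_deriv_on I01 u u1 ->
  has_deriv_on I01oc (fun t => u (t `^ kap a))
    (fun t => u1 (t `^ kap a) * (kap a * t `^ (kap a - 1))).
Proof.
move=> a0 du; have /andP[k0 _] := kap_gt0 a0.
have sub t : I01oc t -> I01 (t `^ kap a).
  by move=> /andP[t0 t1]; apply: powR_I01 => //; rewrite /I01 /= (ltW t0).
exact: (has_deriv_on_comp du (@has_deriv_on_powR (kap a)) sub (powR_inj0 k0)).
Qed.

Lemma has_deriv_on_vfun a p u u1 : 0 < a -> has_deriv_on I01 u u1 ->
  has_deriv_on I01oc (vfun a p u) (vfun1 a p u1).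
Proof. by move=> a0 du; exact: (has_deriv_on_scale (has_deriv_on_powR_comp a0 du)). Qed.

(** The weight cancels since r^a t^(2k-2) = 1 for r = t^k, and the height factor k^(2/(p-1)) absorbs
    the remaining k^2. The first-order coefficients combine to k (N-1) - (k-1) = M - 1. *)
Lemma has_deriv_on_vfun1 N a p u u1 u2 : 1 < p -> 0 < a -> has_deriv_on I01 u1 u2 ->
  (forall r, 0 < r <= 1 -> u2 r = - ((N - 1) / r * u1 r) - r `^ a * phi p (u r)) ->
  has_deriv_on I01oc (vfun1 a p u1) (vfun2 N a p u u1).
Proof.
move=> p1 a0 du1 ode; have /andP[k0 k1] := kap_gt0 a0.
have h := has_deriv_on_scale (c := kap a `^ (2 / (p - 1)))
  (has_deriv_on_mul (has_deriv_on_powR_comp a0 du1)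
    (has_deriv_on_scale (c := kap a) (@has_deriv_on_powR (kap a - 1)))).
apply: (has_deriv_on_ext h) => t It; have /andP[t0 t1] := It.
rewrite /vfun2 /vfun1 /vfun.
rewrite phiM ?powR_ge0// -powRrM divfK; last by rewrite gt_eqF//; lra.
rewrite (powR_mulrn 2 (ltW k0)).
rewrite (ode _ (powR_I0 a0 It)).
(* All powers of t are expressed through q and t, so that [field] can finish. *)
set q := t `^ (kap a - 1 - 1).
have tn : t != 0 by rewrite gt_eqF.
have e1 : t `^ (kap a - 1) = q * t.
  by rewrite /q -powRSpos// subrK.
have e2 : t `^ kap a = q * t * t.
  by rewrite -e1 -powRSpos// subrK.
have q0 : q != 0 by rewrite gt_eqF// powR_gt0.
have e3 : (t `^ kap a) `^ a * (q * t) ^+ 2 = 1.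
  rewrite -e1 -powRrM -(powR_mulrn 2 (powR_ge0 _ _)) -powRrM -powRDpos//.
  rewrite (_ : _ + _ = 0) ?powRr0// /kap; field.
  by rewrite gt_eqF//; lra.
rewrite {1}e1.
move: e3; set ra := (_ `^ a); set U := u1 _; set P := phi p _.
rewrite e1 /dimM !e2 => e3.
have -> : kap a ^+ 2 * kap a `^ (2 / (p - 1)) * P
  = kap a ^+ 2 * kap a `^ (2 / (p - 1)) * P * (ra * (q * t) ^+ 2) by rewrite e3 mulr1.
by field; rewrite q0 tn.
Qed.

End ChangeOfVariable.

(** * The transformed solution up to the origin *)

Section TransformedEquation.
Context {R : realType}.
Variables (N p a : R) (u u1 u2 : R -> R).

Lemma near_I01oc (t : R) : 0 < t < 1 -> \forall y \near nbhs t, I01oc y.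
Proof.
move=> /andP[t0 t1].
have h : t / 2 < t < 1 by apply/andP; split; lra.
by apply: filterS (near_seg h) => y /andP[y1 y2]; apply/andP; split; lra.
Qed.

Lemma cont_vfun : 0 < a -> has_deriv_on I01 u u1 -> cont_on (seg 0 1) (vfun a p u).
Proof.
move=> a0 du; have /andP[k0 _] := kap_gt0 a0.
apply: cont_onM; first exact: cont_on_cst.
apply: (@cont_on_comp _ _ (seg 0 1) (fun t => t `^ kap a) u).
- by move=> t ht; exact: powR_I01.
- by apply: cont_on_sub (powR_cont_on k0) => t /andP[].
- exact: has_deriv_on_cont du.
Qed.

Hypotheses (N2 : 2 < N) (p1 : 1 < p) (a0 : 0 < a).
Hypotheses (du : has_deriv_on I01 u u1) (du1 : has_deriv_on I01 u1 u2).
Hypotheses (u10 : u1 0 = 0) (uE : u 1 = 0).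
Hypothesis ode :
  forall r, 0 < r <= 1 -> u2 r = - ((N - 1) / r * u1 r) - r `^ a * phi p (u r).

Let k0 : 0 < kap a.
Proof. by have /andP[] := kap_gt0 a0. Qed.

Lemma dimM_gt2 : 2 < dimM N a.
Proof. by rewrite /dimM ltrDl mulr_gt0// subr_gt0. Qed.

Lemma der_vfun (t : R) : 0 < t < 1 -> is_derive t 1 (vfun a p u) (vfun1 a p u1 t) /\
  is_derive t 1 (vfun1 a p u1) (vfun2 N a p u u1 t).
Proof.
move=> t01; have nI := near_I01oc t01; have It : I01oc t := nbhs_singleton nI.
split; first exact: (der_of_hdo (has_deriv_on_vfun (p := p) a0 du) It nI).
exact: (der_of_hdo (has_deriv_on_vfun1 p1 a0 du1 ode) It nI).
Qed.

Lemma vfun1_0 : vfun1 a p u1 0 = 0.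
Proof. by rewrite /vfun1 powR0 ?u10 ?mul0r ?mulr0// gt_eqF. Qed.

(** The chain rule leaves a singular factor t^(k-1) at 0. The equation already holds inside the
    interval, so the integrating factor estimate [damped_bound] gives a linear bound instead. *)
Lemma vfun1_bound : exists2 C, 0 <= C & forall t, 0 <= t <= 1 -> `|vfun1 a p u1 t| <= C * t.
Proof.
have pp := p1; have MM := dimM_gt2.
have cphi : cont_on (seg 0 1) (fun t => phi p (vfun a p u t)).
  apply: (@cont_on_comp _ _ setT (vfun a p u) (phi p)) => //; first exact: cont_vfun.
  by apply: cont_onT; exact: phi_cont.
have [C hC] := cont_on_bounded (@ler01 R) cphi.
have C0 : 0 <= C.
  have := hC 0; rewrite lexx ler01 => /(_ isT); exact: le_trans.
exists C => // t /andP[]; rewrite le_eqVlt => /orP[/eqP <- _|t0 t1].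
  by rewrite vfun1_0 normr0 mulr0.
apply: (@damped_bound R (dimM N a) 1 C (vfun1 a p u1) (fun t => phi p (vfun a p u t))).
- lra.
- exact: C0.
- by move=> s /der_vfun[_].
- by move=> s /andP[s0 s1]; apply: hC; rewrite !ltW.
(* Since (M-1) + (k-1) = k (N-1) > 0, the product of s^(M-1) with [vfun1] has no singular power
   left. *)
- pose F (s : R) := kap a `^ (2 / (p - 1)) * kap a * (s `^ (kap a * (N - 1)) * u1 (s `^ kap a)).
  have kN : 0 < kap a * (N - 1) by rewrite mulr_gt0//; have := N2; lra.
  apply: (@cont_on_eq _ _ F).
    move=> s /andP[]; rewrite le_eqVlt => /orP[/eqP <- _|s0 s1].
      by rewrite /F vfun1_0 powR0 ?gt_eqF// mul0r !mulr0.
    rewrite /F /vfun1 (_ : kap a * (N - 1) = (dimM N a - 1) + (kap a - 1)).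
      by rewrite (powRDpos (dimM N a - 1))//; ring.
    by rewrite /dimM; ring.
  apply: cont_onM; first exact: cont_on_cst.
  apply: cont_onM; first by apply: cont_on_sub (powR_cont_on kN) => s /andP[].
  apply: (@cont_on_comp _ _ (seg 0 1) (fun t => t `^ kap a) u1).
  + by move=> s hs; exact: powR_I01.
  + by apply: cont_on_sub (powR_cont_on k0) => s /andP[].
  + exact: has_deriv_on_cont du1.
- by rewrite vfun1_0 mulr0.
- by rewrite t0.
Qed.

Lemma linear_bound_cont (f : R -> R) (A : set R) (C : R) : 0 <= C -> A `<=` [set t | 0 <= t] ->
  (forall t, A t -> `|f t| <= C * t) -> f 0 = 0 -> f @ within A (nbhs 0) --> f 0.
Proof.
move=> C0 A0 fC f0; rewrite f0; apply/(@cvgrPdistC_lt _ R) => e e0.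
have d0 : 0 < e / (C + 1) by rewrite divr_gt0//; lra.
have h : nbhs (0 : R) (fun y => A y -> `|f y - 0| < e).
  apply/nbhs_ballP; exists (e / (C + 1)) => // y.
  rewrite /ball /= sub0r normrN ltr_pdivlMr; last by lra.
  move=> hy Ay; have y0 := A0 y Ay; rewrite /= in y0.
  rewrite (ger0_norm y0) in hy; rewrite subr0.
  by apply: le_lt_trans (fC y Ay) _; lra.
exact: h.
Qed.

Lemma cont_vfun1 : cont_on (seg 0 1) (vfun1 a p u1).
Proof.
have [C C0 hC] := vfun1_bound.
move=> t /andP[]; rewrite le_eqVlt => /orP[/eqP <- _|t0 t1].
  apply: (@linear_bound_cont _ _ C) => //; last exact: vfun1_0.
  by move=> s /andP[].
have It : I01oc t by apply/andP.
have h := has_deriv_on_cont (has_deriv_on_vfun1 p1 a0 du1 ode) It.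
have h2 : within (seg 0 1) (nbhs t) --> within I01oc (nbhs t).
  move=> P hP.
  have hP' : nbhs t (fun y => I01oc y -> P y) by exact: hP.
  have hpos : nbhs t (fun y : R => 0 < y) by exact: lt_nbhsr.
  have h3 : nbhs t (fun y => seg 0 1 y -> P y).
    near=> y => /andP[y0 y1]; apply: (near hP' y) => //.
    by rewrite /I01oc /= y1 andbT; near: y.
  exact: h3.
by apply: cvg_trans h; apply: cvg_app.
Unshelve. all: by end_near. Qed.

Lemma emden_vfun : emden (dimM N a) p 1 (vfun a p u) (vfun1 a p u1).
Proof.
split.
- exact: cont_vfun.
- exact: cont_vfun1.
- exact: vfun1_0.
- by rewrite /vfun powR1 uE mulr0.
- exact: der_vfun.
Qed.

(** At 0 the mean value theorem and the linear bound on [vfun1] bound the difference quotient by C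
    y, so the derivative there is 0. *)
Lemma has_deriv_on_vfun_I01 : has_deriv_on I01 (vfun a p u) (vfun1 a p u1).
Proof.
move=> t /andP[]; rewrite le_eqVlt => /orP[/eqP <- _|t0 t1]; last first.
  have It : I01oc t by apply/andP.
  apply: (has_deriv_on_eq_near (has_deriv_on_vfun (p := p) a0 du) It) => //.
  have hpos : nbhs t (fun y : R => 0 < y) by exact: lt_nbhsr.
  by apply: filterS hpos => y y0 /andP[_ y1]; apply/andP.
have [C C0 hC] := vfun1_bound.
have [cv _ _ _ dv] := emden_vfun.
have h : forall y, I01 y -> `|(vfun a p u y - vfun a p u 0) / (y - 0)| <= C * y.
  move=> y /andP[y0 y1]; rewrite subr0.
  move: y0; rewrite le_eqVlt => /orP[/eqP <-|y0]; first by rewrite invr0 mulr0 normr0 mulr0.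
  rewrite normrM normfV (gtr0_norm y0) ler_pdivrMr// -[X in _ * X](subr0 y).
  apply: (@deriv_bound R _ (vfun1 a p u1)); first exact: ltW.
  - by apply: cont_on_sub cv => s /andP[s0 sy]; apply/andP; split => //; exact: le_trans y1.
  - by move=> s /andP[s0 sy]; apply: (dv s _).1; rewrite s0 (lt_le_trans sy).
  - move=> s /andP[s0 sy]; apply: (le_trans (hC s _)); first by rewrite (ltW s0)/= (le_trans (ltW sy)).
    by rewrite ler_wpM2l// ltW.
have hc := @linear_bound_cont (fun y => (vfun a p u y - vfun a p u 0) / (y - 0)) I01 C C0.
have hl : (fun y => (vfun a p u y - vfun a p u 0) / (y - 0)) @ within I01 (nbhs 0) --> vfun1 a p u1 0.
  have := hc _ h; rewrite vfun1_0 subrr mul0r; apply => //.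
  by move=> y /andP[].
have hp := cvg_trans (cvg_app _ (@punctured_sub_within _ I01 0)) hl.
exact: hp.
Qed.

End TransformedEquation.

(** * Rescaling to unit height *)

Section Rescaling.
Context {R : realType}.
Implicit Types (M N p L d t : R) (v w : R -> R).

(** The length L with L^2 = d^(p-1), on which the unit-height profile of a solution of height d
    lives. *)
Definition scale_len p d : R := d `^ ((p - 1) / 2).

Lemma scale_len_gt0 p d : 0 < d -> 0 < scale_len p d.
Proof. exact: powR_gt0. Qed.

Lemma scale_len_sqr p d : scale_len p d ^+ 2 = d `^ (p - 1).
Proof. by rewrite -powR_mulrn ?powR_ge0// -powRrM divfK. Qed.

Definition rescale p d v (s : R) : R := d^-1 * v (s / scale_len p d).

Definition rescale1 p d v1 (s : R) : R := (d * scale_len p d)^-1 * v1 (s / scale_len p d).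

Lemma rescaleK p d v t : 0 < d -> v t = d * rescale p d v (scale_len p d * t).
Proof.
move=> d0; rewrite /rescale mulrA divff ?gt_eqF// mul1r.
by rewrite mulrAC divff ?mul1r// gt_eqF// scale_len_gt0.
Qed.

Lemma rescale1K p d v1 t : 0 < d ->
  v1 t = d * scale_len p d * rescale1 p d v1 (scale_len p d * t).
Proof.
move=> d0; have l0 := scale_len_gt0 p d0; rewrite /rescale1 mulrA divff ?gt_eqF ?mulr_gt0// mul1r.
by rewrite mulrAC divff ?mul1r// gt_eqF.
Qed.

Lemma div_scale_seg L s : 0 < L -> seg 0 L s -> seg 0 1 (s / L).
Proof.
move=> L0 /andP[s0 sL]; apply/andP; split; first by rewrite divr_ge0// ltW.
by rewrite ler_pdivrMr// mul1r.
Qed.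

(** The homogeneity of [phi] produces the factor d^(p-1) d = L^2 d, which is exactly what two
    derivatives of d y(L t) produce. *)
Lemma normalised_rescale M p v v1 : 1 < p -> 2 <= M <= 3 -> emden M p 1 v v1 -> 0 < v 0 ->
  normalised M p (scale_len p (v 0)) (rescale p (v 0) v) (rescale1 p (v 0) v1).
Proof.
move=> p1 M23 [cv cv1 v10 vE dv] d0; set d := v 0; set L := scale_len p d.
have L0 : 0 < L by exact: scale_len_gt0.
have cdiv : cont_on (seg 0 L) (fun s => s / L).
  by apply: cont_onM; [exact: cont_on_id|exact: cont_on_cst].
have ddiv (s : R) : is_derive s 1 (fun s => s / L) L^-1.
  by have := derM (der_id s) (der_cst L^-1 s); rewrite mulr0 add0r mulr1.
split => //; last by rewrite /rescale mul0r mulVf// gt_eqF.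
split.
- apply: cont_onM; first exact: cont_on_cst.
  by apply: (@cont_on_comp _ _ (seg 0 1) (fun s => s / L) v) => // s; exact: div_scale_seg.
- apply: cont_onM; first exact: cont_on_cst.
  by apply: (@cont_on_comp _ _ (seg 0 1) (fun s => s / L) v1) => // s; exact: div_scale_seg.
- by rewrite /rescale1 mul0r v10 mulr0.
- by rewrite /rescale -/L divff ?vE ?mulr0// gt_eqF.
- move=> s /andP[s0 sL].
  have sI : 0 < s / L < 1 by rewrite divr_gt0//= ltr_pdivrMr// mul1r.
  have [e1 e2] := dv _ sI.
  have dn : d != 0 by rewrite gt_eqF.
  have Ln : L != 0 by rewrite gt_eqF.
  have sn : s != 0 by rewrite gt_eqF.
  split.
    apply: (derE (der_scale d^-1 (der_comp (g := fun s => s / L) e1 (ddiv s)))).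
    by rewrite /rescale1 -/L; field; rewrite Ln dn.
  apply: (derE (der_scale (d * L)^-1 (der_comp (g := fun s => s / L) e2 (ddiv s)))).
  have -> : phi p (v (s / L)) = L ^+ 2 * d * phi p (rescale p d v s).
    by rewrite scale_len_sqr -phiM ?(ltW d0)// /rescale mulrA divff// mul1r.
  by rewrite /rescale1 -/L; field; rewrite Ln dn sn.
Qed.

Lemma zeros_rescale p d v (m : nat) : 0 < d -> (zeros 1 v #= `I_m)%card ->
  (zeros (scale_len p d) (rescale p d v) #= `I_m)%card.
Proof.
move=> d0; set L := scale_len p d; have L0 : 0 < L by exact: scale_len_gt0.
have inj : {in zeros L (rescale p d v) &, injective (fun s => s / L)}.
  by move=> x y _ _; apply: mulIf; rewrite invr_neq0// gt_eqF.
rewrite -(card_eql (inj_card_eq inj)); congr (_ #= _)%card.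
apply/seteqP; split.
  move=> t [/andP[t0 t1] vt]; exists (t * L); last by rewrite mulfK// gt_eqF.
  split; first by rewrite mulr_gt0//= ler_piMl// ltW.
  by rewrite /rescale -/L mulfK ?vt ?mulr0// gt_eqF.
move=> _ [s [/andP[s0 sL] hs] <-]; split; first by rewrite divr_gt0//= ler_pdivrMr// mul1r.
by move/eqP: hs; rewrite /rescale mulf_eq0 invr_eq0 gt_eqF//= => /eqP.
Qed.

(** A double zero would contradict the slope bound of [normalised_zero_slope] for the rescaled
    profile. *)
Lemma emden_simple_zeros M p v v1 : 1 < p -> 2 <= M <= 3 -> emden M p 1 v v1 -> 0 < v 0 ->
  forall x, zeros 1 v x -> v1 x != 0.
Proof.
move=> p1 M23 em d0 x [/andP[x0 x1] vx]; apply/eqP => v1x.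
have nv := normalised_rescale p1 M23 em d0.
have L0 := scale_len_gt0 p d0; set L := scale_len p (v 0) in nv L0.
have LI : 0 <= L * x <= L by rewrite (mulr_ge0 (ltW L0) (ltW x0))/= ler_piMr// ltW.
have xE : L * x / L = x by rewrite mulrAC divff ?mul1r// gt_eqF.
have := normalised_zero_slope nv LI; rewrite /rescale /rescale1 -/L xE vx v1x !mulr0.
rewrite expr0n mul0r => /(_ erefl); have := energy_half_gt0 p1; lra.
Qed.

Lemma powR_near (x r e : R) : 0 < x -> 0 < e ->
  exists2 del, 0 < del & forall y, `|y - x| < del -> `|y `^ r - x `^ r| < e.
Proof.
move=> x0 e0; have h := der_cont (is_derive1_powR r x0).
have /(@cvgrPdistC_lt _ R) /(_ e e0) /nbhs_ballP[d /= d0 hd] := h.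
by exists d => // y yx; apply: hd; rewrite /ball /= distrC.
Qed.

(** Both profiles are compared at the smaller of L t and l t, at cost delta. Moving the longer one
    to its own argument costs at most 3 delta by the Lipschitz bounds. *)
Lemma normalised_close_rescaled N p l g g1 (m : nat) (delta : R) :
  normalised N p l g g1 -> (zeros l g #= `I_m)%card -> 0 < delta ->
  exists2 e, 0 < e & forall M L f f1, normalised M p L f f1 ->
    (zeros L f #= `I_m)%card -> `|M - N| <= e ->
    `|L - l| < delta /\ forall t, 0 <= t <= 1 ->
      `|f (L * t) - g (l * t)| < 4 * delta /\ `|f1 (L * t) - g1 (l * t)| < 4 * delta.
Proof.
move=> ng Zg d0; have [e e0 he] := normalised_close ng Zg d0.
exists e => // M L f f1 nf Zf MN; have [Ll close] := he M L f f1 nf Zf MN.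
split => // t /andP[t0 t1].
have L1 := normalised_len nf; have l1 := normalised_len ng.
have Lt : 0 <= L * t <= L by rewrite mulr_ge0 ?ler_piMr//; lra.
have lt : 0 <= l * t <= l by rewrite mulr_ge0 ?ler_piMr//; lra.
have dist : `|L - l| * t <= delta.
  by apply: (@le_trans _ _ `|L - l|); [rewrite ler_piMr|exact: ltW].
case: (leP L l) => LL.
  have LLt : L * t <= l * t by rewrite ler_wpM2r.
  have LE : `|L - l| * t = l * t - L * t by rewrite distrC ger0_norm ?subr_ge0//; ring.
  have [a1 a2] := close (L * t) Lt ltac:(lra).
  have [b1 b2] := normalised_lip ng (proj1 (andP Lt)) LLt ltac:(lra).
  rewrite distrC in b1; rewrite distrC in b2.
  split.
    have := ler_distD (g (L * t)) (f (L * t)) (g (l * t)); lra.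
  have := ler_distD (g1 (L * t)) (f1 (L * t)) (g1 (l * t)); lra.
have LLt : l * t <= L * t by rewrite ler_wpM2r// ltW.
have LE : `|L - l| * t = L * t - l * t by rewrite gtr0_norm ?subr_gt0//; ring.
have [a1 a2] := close (l * t) ltac:(lra) ltac:(lra).
have [b1 b2] := normalised_lip nf (proj1 (andP lt)) LLt ltac:(lra).
split.
  have := ler_distD (f (l * t)) (f (L * t)) (g (l * t)); lra.
have := ler_distD (f1 (l * t)) (f1 (L * t)) (g1 (l * t)); lra.
Qed.

Lemma scale_len_inv p d : 1 < p -> 0 < d -> d = scale_len p d `^ (2 / (p - 1)).
Proof.
move=> p1 d0; rewrite -powRrM (_ : _ * _ = 1) ?powRr1 ?(ltW d0)//.
by field; rewrite gt_eqF//; lra.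
Qed.

Lemma prod_close (A a Y y C eta delta : R) : `|A - a| <= eta -> `|Y - y| <= delta ->
  `|a| <= C -> eta <= 1 -> `|y| <= 1 -> `|A * Y - a * y| <= (C + 1) * delta + eta.
Proof.
move=> h1 h2 h3 h4 h5.
have -> : A * Y - a * y = A * (Y - y) + (A - a) * y by ring.
apply: (le_trans (ler_normD _ _)); rewrite !normrM; apply: lerD.
  apply: ler_pM => //.
  have -> : A = a + (A - a) by ring.
  by apply: (le_trans (ler_normD _ _)); lra.
by rewrite -[leRHS]mulr1; apply: ler_pM.
Qed.

Lemma scaled_le_quarter (C x e : R) : 0 < C -> x <= e / (16 * (C + 1)) -> (C + 1) * (4 * x) <= e / 4.
Proof.
move=> C0; have C1 : 0 < 16 * (C + 1) by lra.
rewrite ler_pdivlMr// => h; lra.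
Qed.

(** The factors d and d L restoring v and v1 from their profiles are the powers q and q + 1 of the
    length, with q = 2/(p-1). Close lengths therefore give close factors, and [prod_close] combines
    these with close profiles. *)
Lemma emden_close N p w w1 (m : nat) (e : R) : 1 < p -> 2 <= N <= 3 ->
  emden N p 1 w w1 -> 0 < w 0 -> (zeros 1 w #= `I_m)%card -> 0 < e ->
  exists2 e', 0 < e' & forall M v v1, 2 <= M <= 3 -> emden M p 1 v v1 -> 0 < v 0 ->
    (zeros 1 v #= `I_m)%card -> `|M - N| <= e' ->
    forall t, 0 <= t <= 1 -> `|v t - w t| < e /\ `|v1 t - w1 t| < e.
Proof.
move=> p1 N23 ew w0 Zw e0.
set d := w 0 in w0; set l := scale_len p d.
have l0 : 0 < l by exact: scale_len_gt0.
have nw := normalised_rescale p1 N23 ew w0; rewrite -/d -/l in nw.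
have Zz := zeros_rescale p w0 Zw; rewrite -/l in Zz.
set q := 2 / (p - 1).
have ldE : d * l = l `^ (q + 1) by rewrite powRSpos// -scale_len_inv.
pose C := d + d * l.
have dl0 : 0 < d * l by exact: mulr_gt0.
have C0 : 0 < C by exact: addr_gt0.
have n1 : `|d| <= C by rewrite (gtr0_norm w0) lerDl ltW.
have n2 : `|d * l| <= C by rewrite (gtr0_norm dl0) lerDr ltW.
pose eta := Num.min 1 (e / 4).
have eta0 : 0 < eta by rewrite lt_min; lra.
have [etaA etaB] : eta <= 1 /\ eta <= e / 4 by rewrite /eta !ge_min !lexx orbT.
have [del1 del10 h1] := powR_near q l0 eta0.
have [del2 del20 h2] := powR_near (q + 1) l0 eta0.
pose delta := Num.min (Num.min del1 del2) (e / (16 * (C + 1))).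
have delta0 : 0 < delta by rewrite !lt_min del10 del20 divr_gt0//; lra.
have [dA [dB dC]] : delta <= del1 /\ delta <= del2 /\ delta <= e / (16 * (C + 1)).
  by rewrite /delta !ge_min; split; [|split]; rewrite lexx ?orbT.
have [e' e'0 he] := normalised_close_rescaled nw Zz delta0.
exists e' => // M v v1 M23 ev v0 Zv MN t t01.
set D := v 0 in v0; set L := scale_len p D.
have nv := normalised_rescale p1 M23 ev v0; rewrite -/D -/L in nv.
have Zy := zeros_rescale p v0 Zv; rewrite -/L in Zy.
have [Ll close] := he _ _ _ _ nv Zy MN.
have L0 : 0 < L by exact: scale_len_gt0.
have LDE : D * L = L `^ (q + 1) by rewrite powRSpos// -scale_len_inv.
have [k1 k2] := close t t01.
have hD : `|D - d| < eta.
  by rewrite (scale_len_inv p1 v0) (scale_len_inv p1 w0) -/q; apply: h1; exact: lt_le_trans Ll dA.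
have hDL : `|D * L - d * l| < eta.
  by rewrite LDE ldE; apply: h2; exact: lt_le_trans Ll dB.
have lt : 0 <= l * t <= l by case/andP: t01 => t0 t1; rewrite mulr_ge0 ?ler_piMr// ltW.
have [b1 b2] := normalised_le1 nw lt.
have bd := scaled_le_quarter C0 dC.
rewrite (rescaleK p v t v0) (rescaleK p w t w0) (rescale1K p v1 t v0) (rescale1K p w1 t w0).
rewrite -/L -/l.
have fin : (C + 1) * (4 * delta) + eta < e.
  by move: bd etaB e0; clear; set X := _ * _ => *; lra.
split.
  exact: le_lt_trans (prod_close (ltW hD) (ltW k1) n1 etaA b1) fin.
exact: le_lt_trans (prod_close (ltW hDL) (ltW k2) n2 etaA b2) fin.
Qed.

(** Zeros of u and of v correspond under t -> t^k. Simplicity is known for v from the energy bound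
    and passes to u by the chain rule, which allows the nodal sets of u to be counted by zeros. *)
Lemma zeros_vfun N a p u u1 u2 (m : nat) : 2 < N -> 1 < p -> 0 < a -> dimM N a <= 3 ->
  has_deriv_on I01 u u1 -> has_deriv_on I01 u1 u2 -> u1 0 = 0 -> u 1 = 0 ->
  (forall r, 0 < r <= 1 -> u2 r = - ((N - 1) / r * u1 r) - r `^ a * phi p (u r)) ->
  has_n_nodal_sets u m -> 0 < u 0 -> (zeros 1 (vfun a p u) #= `I_m)%card.
Proof.
move=> N2 p1 a0 M3 du du1 u10 uE ode nod u0.
have /andP[k0 k1] := kap_gt0 a0.
have c0 : 0 < kap a `^ (2 / (p - 1)) by exact: powR_gt0.
have ev := emden_vfun N2 p1 a0 du du1 u10 uE ode.
have v0 : 0 < vfun a p u 0 by rewrite /vfun powR0 ?mulr_gt0// gt_eqF.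
have M23 : 2 <= dimM N a <= 3 by rewrite M3 andbT ltW// dimM_gt2.
have vz t : 0 < t <= 1 -> (vfun a p u t = 0) <-> (u (t `^ kap a) = 0).
  move=> _; rewrite /vfun; split => [/eqP|->]; last by rewrite mulr0.
  by rewrite mulf_eq0 gt_eqF//= => /eqP.
have root x : 0 < x <= 1 -> exists2 t, 0 < t <= 1 & t `^ kap a = x.
  move=> /andP[x0 x1]; exists (x `^ (kap a)^-1); last first.
    by rewrite -powRrM mulVf ?powRr1 ?(ltW x0)// gt_eqF.
  rewrite powR_gt0//=; have := @ge0_ler_powR R (kap a)^-1 _ x 1.
  by rewrite !nnegrE powR1 invr_ge0; apply => //; exact: ltW.
have simple x : zeros 1 u x -> u1 x != 0.
  move=> [x01 ux]; have [t t01 tx] := root x x01.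
  have Zt : zeros 1 (vfun a p u) t by split => //; apply/vz => //; rewrite tx.
  have := emden_simple_zeros p1 M23 ev v0 Zt; rewrite /vfun1 tx.
  by apply: contraNneq => ->; rewrite mul0r mulr0.
have Zu := nodal_zeros (has_deriv_on_cont du) uE (has_deriv_on_zeros_isolated du simple) nod.
have inj : {in zeros 1 (vfun a p u) &, injective (fun t => t `^ kap a)}.
  move=> x y /set_mem [hx _] /set_mem [hy _]; apply: (powR_inj0 k0); exact: mem_set.
rewrite -(card_eql (inj_card_eq inj)) (_ : _ @` _ = zeros 1 u)//.
apply/seteqP; split.
  move=> _ [t [t01 vt] <-]; split; first exact: (powR_I0 a0 t01).
  exact/(vz t t01).
move=> x [x01 ux]; have [t t01 tx] := root x x01.
by exists t => //; split => //; apply/vz => //; rewrite tx.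
Qed.

End Rescaling.

(** * Convergence of the transformed solutions *)

Theorem theorem1p1 (R : realType) (N : nat) (p : R) (m : nat)
  (hN : (3 <= N)%N) (hp : 1 < p)
  (u : R -> R -> R)
  (hu : forall a : R, alpha_p N%:R p < a ->
          [/\ radial_sol N%:R a p (u a), has_n_nodal_sets (u a) m & 0 < u a 0])
  (w : R -> R)
  (hw : [/\ radial_sol 2 0 p w, has_n_nodal_sets w m & 0 < w 0]) :
  let v := fun (a t : R) =>
    (2 / (a + 2)) `^ (2 / (p - 1)) * u a (t `^ (2 / (a + 2))) in
  exists w1 w2 : R -> R,
    [/\ has_deriv_on I01 w w1, has_deriv_on I01 w1 w2 &
    exists V1 V2 : R -> R -> R,
      [/\ (forall a, alpha_p N%:R p < a ->
             has_deriv_on I01 (v a) (V1 a) /\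
             has_deriv_on [set t | 0 < t <= 1] (V1 a) (V2 a)),
          (forall e : R, 0 < e -> exists A : R, forall a, A < a ->
             alpha_p N%:R p < a -> forall t, I01 t ->
               `|v a t - w t| < e /\ `|V1 a t - w1 t| < e) &
          (forall eps : R, 0 < eps < 1 -> forall e : R, 0 < e ->
             exists A : R, forall a, A < a -> alpha_p N%:R p < a ->
               forall t, eps <= t <= 1 -> `|V2 a t - w2 t| < e)]].
Proof.
move=> v.
have N2 : 2 < N%:R :> R by rewrite ltr_nat.
have apos a : alpha_p N%:R p < a -> 0 < a.
  by apply: le_lt_trans; rewrite /alpha_p le_max lexx.
have [[w1 [w2 [dw dw1 cw2 [w10 wE] odew]]] nodw w0] := hw.
have odew' := radial_ode_end hp dw dw1 cw2 wE odew.
have ode2 t : 0 < t <= 1 -> w2 t = - (1 / t * w1 t) - phi p (w t).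
  move=> /odew' ->; rewrite powRr0 mul1r; congr (- (_ / t * _) - _); lra.
have ew : emden 2 p 1 w w1.
  split; [exact: has_deriv_on_cont dw|exact: has_deriv_on_cont dw1|exact: w10|exact: wE|].
  move=> t t01; have tI : 0 <= t <= 1 by lra.
  split; first exact: (der_of_hdo dw tI (near_seg t01)).
  apply: (derE (der_of_hdo dw1 tI (near_seg t01))).
  rewrite ode2; last by lra.
  by congr (- (_ / t * _) - _); lra.
have M2 : 2 <= (2 : R) <= 3 by lra.
have Zw := nodal_zeros (has_deriv_on_cont dw) wE
  (has_deriv_on_zeros_isolated dw (emden_simple_zeros hp M2 ew w0)) nodw.
(* The derivative of [u a] is chosen as a function of a; the zero function is a filler for exponents
   outside the admissible range. *)
have /choice[U1 hU] : forall a, exists u1, alpha_p N%:R p < a -> exists u2,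
    [/\ has_deriv_on I01 (u a) u1, has_deriv_on I01 u1 u2, u1 0 = 0 /\ u a 1 = 0 &
      forall r, 0 < r <= 1 -> u2 r = - ((N%:R - 1) / r * u1 r) - r `^ a * phi p (u a r)].
  move=> a; have [aA|] := pselect (alpha_p N%:R p < a); last by exists (fun=> 0).
  have [[u1 [u2 [du du1 cu2 [u10 uE] ode]]] _ _] := hu a aA.
  exists u1 => _; exists u2; split => //.
  exact: radial_ode_end hp du du1 cu2 uE ode.
have C1 (e : R) : 0 < e -> exists A : R, forall a, A < a -> alpha_p N%:R p < a ->
    [/\ 2 <= dimM N%:R a <= 3, `|dimM N%:R a - 2| <= e & forall t, 0 <= t <= 1 ->
      `|vfun a p (u a) t - w t| < e /\ `|vfun1 a p (U1 a) t - w1 t| < e].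
  move=> e0; have [e' e'0 close] := emden_close hp M2 ew w0 Zw e0.
  pose b := Num.min (Num.min e e') 1.
  have b0 : 0 < b by rewrite !lt_min e0 e'0 ltr01.
  have [b1 [b2 b3]] : b <= e /\ b <= e' /\ b <= 1.
    by rewrite /b !ge_min; split; [|split]; rewrite lexx ?orbT.
  (* The effective dimension exceeds 2 by 2(N-2)/(a+2), which is at most b beyond this threshold. *)
  exists (2 * (N%:R - 2) / b) => a aA aa; have a0 := apos a aa.
  have [u2 [du du1 [u10 uE] ode]] := hU a aa.
  have [_ nod u0] := hu a aa.
  have Md : dimM N%:R a - 2 <= b.
    rewrite /dimM /kap addrAC subrr add0r mulrAC ler_pdivrMr; last by lra.
    move: aA; rewrite ltr_pdivrMr// mulrC; nra.
  have Mg := dimM_gt2 N2 a0.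
  have M23 : 2 <= dimM N%:R a <= 3 by lra.
  have nM : `|dimM N%:R a - 2| <= b by rewrite ger0_norm //; lra.
  split => //; first exact: le_trans nM b1.
  have [/andP[k0 _] M3] : 0 < kap a < 1 /\ dimM N%:R a <= 3 by split; [exact: kap_gt0|lra].
  have v0 : 0 < vfun a p (u a) 0 by rewrite /vfun powR0 ?mulr_gt0 ?powR_gt0// gt_eqF.
  apply: (close _ _ _ M23) => //.
  - exact: emden_vfun N2 hp a0 du du1 u10 uE ode.
  - exact: zeros_vfun N2 hp a0 M3 du du1 u10 uE ode nod u0.
  - exact: le_trans nM b2.
exists w1, w2; split => //.
exists (fun a => vfun1 a p (U1 a)), (fun a => vfun2 N%:R a p (u a) (U1 a)); split.
- move=> a aa; have a0 := apos a aa.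
  have [u2 [du du1 [u10 uE] ode]] := hU a aa; split.
    exact: (has_deriv_on_vfun_I01 N2 hp a0 du du1 u10 uE ode).
  exact: (has_deriv_on_vfun1 hp a0 du1 ode).
- by move=> e /C1[A hA]; exists A => a aA aa t; have [_ _] := hA a aA aa; apply.
move=> eps /andP[eps0 eps1] e e0.
have [B1 hB1] := cont_on_bounded (@ler01 R) (has_deriv_on_cont dw).
have [B2 hB2] := cont_on_bounded (@ler01 R) (has_deriv_on_cont dw1).
(* The extra 1 lets B bound [V] and [V1] as well, since they are within e1 <= 1 of w and w1. *)
pose B := Num.max B1 B2 + 1.
have I0 : 0 <= (0 : R) <= 1 by lra.
have [BA BB] : B1 + 1 <= B /\ B2 + 1 <= B by rewrite /B !lerD2r !le_max !lexx orbT.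
have Bp : 1 <= B by have := hB1 0 I0; have := normr_ge0 (w 0); lra.
(* The difference of the second derivatives will be at most e1 K: the first summand bounds the
   damping terms, with 1/t <= 1/eps, and the second is the Lipschitz constant of [phi]. *)
pose K := (B + 1) / eps + p * B `^ (p - 1).
have K0 : 0 < K.
  apply: addr_gt0; first by rewrite divr_gt0//; lra.
  by rewrite mulr_gt0 ?powR_gt0//; lra.
pose e1 := Num.min 1 (e / (2 * K)).
have e10 : 0 < e1 by rewrite lt_min ltr01 divr_gt0// mulr_gt0.
have [e1A e1B] : e1 <= 1 /\ e1 <= e / (2 * K) by rewrite /e1 !ge_min !lexx orbT.
have [A hA] := C1 e1 e10; exists A => a aA aa t /andP[te t1].
have [M23 MM cl] := hA a aA aa.
have t0 : 0 < t := lt_le_trans eps0 te.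
have tI : 0 <= t <= 1 by rewrite (ltW t0).
have [k1 k2] := cl t tI.
rewrite ode2 ?t0// /vfun2.
set V := vfun a p (u a) t in k1 *; set V1 := vfun1 a p (U1 a) t in k2 *.
have wB := hB1 t tI; have w1B := hB2 t tI.
have VB : `|V| <= B.
  have := ler_normD (V - w t) (w t); rewrite subrK; lra.
have V1B : `|V1| <= B.
  have := ler_normD (V1 - w1 t) (w1 t); rewrite subrK; lra.
have wB' : `|w t| <= B by lra.
have hphi := phi_lip hp wB' VB.
set M := dimM N%:R a in MM *.
(* The change of dimension, the change of slope and the change of the nonlinearity are separated. *)
have -> : - ((M - 1) / t * V1) - phi p V - (- (1 / t * w1 t) - phi p (w t))
  = - (((M - 2) * V1 + (V1 - w1 t)) / t) - (phi p V - phi p (w t)).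
  by field; rewrite gt_eqF.
apply: (@le_lt_trans _ _ (e1 * K)); last first.
  apply: (@le_lt_trans _ _ (e / (2 * K) * K)); first by rewrite ler_wpM2r// ltW.
  have -> : e / (2 * K) * K = e / 2 by field; rewrite gt_eqF.
  lra.
apply: (le_trans (ler_normB _ _)); rewrite normrN /K mulrDr; apply: lerD.
  have hV : `|(M - 2) * V1 + (V1 - w1 t)| <= e1 * (B + 1).
    apply: (le_trans (ler_normD _ _)); rewrite mulrDr mulr1 normrM.
    by apply: lerD; [apply: ler_pM|exact: ltW].
  rewrite normrM normfV (gtr0_norm t0) [leRHS]mulrA.
  have tV : 0 <= t^-1 by rewrite invr_ge0 ltW.
  have te' : t^-1 <= eps^-1 by rewrite lef_pV2 ?posrE.
  exact: ler_pM.
apply: (le_trans hphi); rewrite mulrC; apply: ler_wpM2r; last exact: ltW.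
by rewrite mulr_ge0 ?powR_ge0//; lra.
Qed.
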